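(* Let $X$ be an infinite discrete space and $G=(\mathrm S(X),\tau_p)$ its permutation group with the topology of pointwise convergence. Then: (a) the Alexandroff one-point compactification $\alpha X=X\cup\{\infty\}$ is the unique $G$-compactification of $X$; (b) $e_{\alpha X}G=b_rG$ (as compactifications of $G$), and $G$ is Roelcke precompact; (c) $b_rG$ is the set of self-maps $f$ of $\alpha X$, with the topology of pointwise convergence, for which there is a subset $Y\subset X$ such that $f|_Y$ is an injection of $Y$ into $X$ and $f(\alpha X\setminus Y)=\{\infty\}$; (d) $b_rG$ is a sim-compactification of $G$, isomorphic to the symmetric inverse semigroup $I_X$, and it is the maximal sm-compactification of $G$ (the WAP-compactification of $G$).
   Context: For a compact $K$ on which $G$ acts, $e_KG$ is the closure of $\{x\mapsto gx: g\in G\}$ in $K^K$ with the product topology (a monoid under composition). The Roelcke uniformity $L\wedge R$ on $G$ has base of covers $\{OgO:g\in G\}$, $O$ a neighbourhood of $e$; $G$ is Roelcke precompact if it is totally bounded, and then the Roelcke compactification $b_rG$ is the completion of $(G,L\wedge R)$. A $G$-compactification of a $G$-space $X$ is the completion with respect to a totally bounded equiuniformity. An sm-compactification (resp. sim-compactification) of $G$ is a compactification $bG$ of $G$ with continuous extended left action of $G$ which is a semitopological monoid (resp. semitopological inverse monoid with continuous inversion) whose multiplication restricted to $G\times bG$ is the extended left action. The symmetric inverse semigroup $I_X$ is the monoid of all partial bijections between subsets of $X$ under composition. *)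

(* Defs.v *)
From HB Require Import structures.
From mathcomp Require Import all_boot all_order all_algebra.
From mathcomp Require Import all_classical all_reals topology.

Set Implicit Arguments.
Unset Strict Implicit.
Unset Printing Implicit Defensive.

Local Open Scope classical_set_scope.

Record sperm (X : Type) := SPerm {
  sp_fun :> X -> X ;
  sp_inv : X -> X ;
  sp_funK : cancel sp_fun sp_inv ;
  sp_invK : cancel sp_inv sp_fun }.

Definition sp_one (X : Type) : sperm X :=
  @SPerm X (fun x => x) (fun x => x) (fun _ => erefl) (fun _ => erefl).

Lemma sp_mul_funK (X : Type) (g h : sperm X) :
  cancel (g \o h) (sp_inv h \o sp_inv g).
Proof. by move=> x /=; rewrite sp_funK sp_funK. Qed.

Lemma sp_mul_invK (X : Type) (g h : sperm X) :
  cancel (sp_inv h \o sp_inv g) (g \o h).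
Proof. by move=> x /=; rewrite sp_invK sp_invK. Qed.

Definition sp_mul (X : Type) (g h : sperm X) : sperm X :=
  SPerm (sp_mul_funK g h) (sp_mul_invK g h).

(* topology of pointwise convergence on S(X), X discrete: a set U is open
   iff every g in U has a basic neighbourhood {h | h = g on F}, F finite. *)
Definition sp_open (X : Type) (U : set (sperm X)) : Prop :=
  forall g, U g -> exists F : set X, finite_set F /\
    forall h : sperm X, (forall x, F x -> h x = g x) -> U h.

Definition fixes (X : Type) (F : set X) (a : sperm X) : Prop :=
  forall x, F x -> a x = x.

(* the Roelcke cover {O_F g O_F : g in G}, as the entourage
   {(g,h) | h in O_F g O_F} (O_F is a subgroup, so double cosets partition G) *)
Definition roelcke_base (X : Type) (F : set X) : set (sperm X * sperm X) :=
  [set gh : sperm X * sperm X | exists a b : sperm X,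
     [/\ fixes F a, fixes F b & forall x, gh.2 x = a (gh.1 (b x))]].

Definition roelcke_ent (X : Type) (E : set (sperm X * sperm X)) : Prop :=
  exists F : set X, finite_set F /\ roelcke_base F `<=` E.

Definition is_uniformity (A : Type) (ent : set (A * A) -> Prop) : Prop :=
  [/\ ent setT /\ (forall E D, ent E -> E `<=` D -> ent D),
      (forall E D, ent E -> ent D -> ent (E `&` D)),
      (forall E, ent E -> forall a, E (a, a)),
      (forall E, ent E -> ent [set ab | E (ab.2, ab.1)]) &
      (forall E, ent E -> exists D, ent D /\
          forall a b c, D (a, b) -> D (b, c) -> E (a, c))].

Definition totally_bounded (A : Type) (ent : set (A * A) -> Prop) : Prop :=
  forall E, ent E -> exists C : set A, finite_set C /\
    forall a, exists c, C c /\ E (c, a).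

Definition equiuniformity (X : Type) (ent : set (X * X) -> Prop) : Prop :=
  [/\ is_uniformity ent,
      (forall (g : sperm X) E, ent E -> exists D, ent D /\
          forall x y, D (x, y) -> E (g x, g y)) &
      (forall E, ent E -> exists F : set X, finite_set F /\
          forall g : sperm X, fixes F g -> forall x, E (x, g x))].

(* Compactifications, realised as a subset K of a topological space T. *)

Definition hausdorff_on (T : topologicalType) (K : set T) : Prop :=
  forall p q, K p -> K q -> p <> q -> exists U V : set T,
    [/\ open U, open V, U p, V q & U `&` V = set0].

Definition compactification_in (A : Type) (openA : set A -> Prop)
    (T : topologicalType) (K : set T) (j : A -> T) : Prop :=
  [/\ compact K /\ hausdorff_on K, (forall a, K (j a)) /\
      K `<=` closure (range j),
      (forall V, open V -> openA (j @^-1` V)),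
      injective j &
      (forall U, openA U -> exists V, open V /\ U = j @^-1` V)].

(* the (unique) uniformity of the compact Hausdorff space K: the
   neighbourhoods of the diagonal of K x K *)
Definition diag_nbhd (T : topologicalType) (K : set T) (W : set (T * T)) :=
  forall p, K p -> exists U : set T, [/\ open U, U p &
    forall x y, K x -> K y -> U x -> U y -> W (x, y)].

(* (K, j) is the completion of the (totally bounded) uniform space
   (A, entA): a compactification whose unique uniformity induces entA on A *)
Definition uniform_completion (A : Type) (openA : set A -> Prop)
    (entA : set (A * A) -> Prop) (T : topologicalType) (K : set T)
    (j : A -> T) : Prop :=
  [/\ compactification_in openA K j,
      (forall W, diag_nbhd K W -> entA [set ab | W (j ab.1, j ab.2)]) &
      (forall E, entA E -> exists W, diag_nbhd K W /\
          forall a b, W (j a, j b) -> E (a, b))].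

Definition compactification_iso (A : Type) (T1 : topologicalType)
    (K1 : set T1) (j1 : A -> T1) (T2 : topologicalType) (K2 : set T2)
    (j2 : A -> T2) : Prop :=
  exists (h : T1 -> T2) (k : T2 -> T1),
    [/\ (forall p, K1 p -> K2 (h p)) /\ (forall q, K2 q -> K1 (k q)),
        (forall p, K1 p -> k (h p) = p) /\ (forall q, K2 q -> h (k q) = q),
        {within K1, continuous h}, {within K2, continuous k} &
        (forall a, h (j1 a) = j2 a)].

Definition G_compactification (X : Type) (T : topologicalType) (K : set T)
    (j : X -> T) : Prop :=
  exists ent : set (X * X) -> Prop,
    [/\ equiuniformity ent, totally_bounded ent &
        uniform_completion (fun _ : set X => True) ent K j].

Definition roelcke_compactification (X : Type) (T : topologicalType)
    (K : set T) (j : sperm X -> T) : Prop :=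
  uniform_completion (@sp_open X) (@roelcke_ent X) K j.

Definition sm_compactification (X : Type) (T : topologicalType) (K : set T)
    (j : sperm X -> T) (mul : T -> T -> T) (one : T) : Prop :=
  [/\ compactification_in (@sp_open X) K j /\
      (K one /\ (forall a b, K a -> K b -> K (mul a b))),
      (forall a b c, K a -> K b -> K c -> mul a (mul b c) = mul (mul a b) c)
        /\ (forall a, K a -> mul one a = a /\ mul a one = a),
      (forall a, K a -> {within K, continuous (mul a)} /\
                        {within K, continuous (fun b => mul b a)}),
      (forall g h : sperm X, mul (j g) (j h) = j (sp_mul g h)) &
      (forall (g : sperm X) p, K p -> forall V : set T, open V ->
         V (mul (j g) p) -> exists (F : set X) (U : set T),
           [/\ finite_set F, open U, U p &
               forall (h : sperm X) q, (forall x, F x -> h x = g x) ->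
                 K q -> U q -> V (mul (j h) q)])].

Definition sim_compactification (X : Type) (T : topologicalType) (K : set T)
    (j : sperm X -> T) (mul : T -> T -> T) (one : T) : Prop :=
  sm_compactification K j mul one /\
  exists inv : T -> T,
    [/\ (forall a, K a -> K (inv a)),
        (forall a, K a -> mul (mul a (inv a)) a = a /\
                          mul (mul (inv a) a) (inv a) = inv a),
        (forall a b, K a -> K b -> mul (mul a b) a = a ->
                     mul (mul b a) b = b -> b = inv a) &
        {within K, continuous inv}].

Definition max_sm_compactification (X : Type) (T : topologicalType)
    (K : set T) (j : sperm X -> T) (mul : T -> T -> T) (one : T) : Prop :=
  sm_compactification K j mul one /\
  forall (T' : topologicalType) (K' : set T') (j' : sperm X -> T')
         (mul' : T' -> T' -> T') (one' : T'),
    sm_compactification K' j' mul' one' ->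
    exists h : T -> T', [/\ (forall p, K p -> K' (h p)),
      {within K, continuous h} & forall g, h (j g) = j' g].

Definition partial_bij (X : Type) (R : X -> X -> Prop) : Prop :=
  (forall x y z, R x y -> R x z -> y = z) /\
  (forall x y z, R x z -> R y z -> x = y).

Definition rel_comp (X : Type) (R S : X -> X -> Prop) : X -> X -> Prop :=
  fun x z => exists y, S x y /\ R y z.

Definition iso_to_IX (X : Type) (T : Type) (K : set T)
    (mul : T -> T -> T) : Prop :=
  exists phi : T -> (X -> X -> Prop),
    [/\ (forall a, K a -> partial_bij (phi a)),
        (forall a b, K a -> K b -> phi a = phi b -> a = b),
        (forall R, partial_bij R -> exists a, K a /\ phi a = R) &
        (forall a b, K a -> K b -> phi (mul a b) = rel_comp (phi a) (phi b))].

Definition alphaX (X : choiceType) : topologicalType :=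
  one_point_compactification (discrete_topology X).

Definition alpha_emb (X : choiceType) : X -> alphaX X := fun x => Some x.

Definition alpha_act (X : choiceType) (g : sperm X) : alphaX X -> alphaX X :=
  fun p => match p with Some x => Some (g x) | None => None end.

Definition selfmaps (X : choiceType) : topologicalType :=
  {ptws alphaX X -> alphaX X}.

Definition ellis_emb (X : choiceType) (g : sperm X) : selfmaps X :=
  alpha_act g.

Definition ellis_space (X : choiceType) : set (selfmaps X) :=
  closure (range (@ellis_emb X)).

Definition brX (X : choiceType) : set (selfmaps X) :=
  [set f : selfmaps X | exists Y : set X,
     [/\ (forall y, Y y -> exists x, f (Some y) = Some x),
         (forall y1 y2, Y y1 -> Y y2 -> f (Some y1) = f (Some y2) -> y1 = y2) &
         (forall p : alphaX X, ~ (exists y, Y y /\ p = Some y) -> f p = None)]].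

Definition selfmaps_comp (X : choiceType) (f g : selfmaps X) : selfmaps X :=
  fun p => f (g p).

Definition selfmaps_id (X : choiceType) : selfmaps X := fun p => p.

Arguments brX X _ : clear implicits.
Arguments selfmaps_id X _ : clear implicits.
Arguments ellis_space X _ : clear implicits.

(* Main.v *)
Require Import Defs.
From HB Require Import structures.
From mathcomp Require Import all_boot all_order all_algebra.
From mathcomp Require Import all_classical all_reals topology.

Local Open Scope classical_set_scope.

(* A partial injection of [X] is determined, near any finite set [F], by the pairs
   [(x, y)] of [F x F] in its graph, and every such finite pattern is realised by
   a permutation; two permutations have the same pattern on [F] exactly when they
   lie in the same double coset of the stabiliser [O_F].  This identifies the
   closure of [G] in the self-maps of [alpha X] with the Roelcke completion.

   For maximality, let [K] be any sm-compactification with embedding [j].  The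
   closure of the graph [{(g, j g)}] is a multiplicative relation between [brX]
   and [K], total by compactness, and it suffices that it is functional.  Over the
   partial identity of a finite [F] its fibre is a single zero [u_F] of the closure
   of [j O_F], by a double limit argument; since [u_F] tends to [1] and [u_F p] lies
   over an element of finite rank, all fibres are singletons. *)

(** * Cluster points and extension of maps in compact spaces *)

Lemma within_continuousP {T S : topologicalType} {K : set T} {f : T -> S} :
  {within K, continuous f} <->
  (forall p, K p -> forall V, open V -> V (f p) -> exists U,
     [/\ open U, U p & forall q, K q -> U q -> V (f q)]).
Proof.
split=> [/subspace_continuousP fK p Kp V oV Vfp|fK].
  have /= := fK p Kp V (open_nbhs_nbhs (conj oV Vfp)).
  rewrite withinE /= nbhsE => -[Z [U [oU Up] UZ] eqZ].
  exists U; split=> // q Kq Uq.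
  have : (Z `&` K) q by split=> //; exact: UZ.
  by rewrite -eqZ => -[].
apply/subspace_continuousP => p Kp V /=; rewrite nbhsE => -[V' [oV' V'p] V'V].
have [U [oU Up UV]] := fK p Kp V' oV' V'p.
rewrite /= !nbhs_simpl /= /within /= nbhsE; exists U => // q Uq Kq.
by apply: V'V; apply: UV.
Qed.

(** The traces of the [B i] on [K] generate a proper filter. In most uses [B i] collects the
    counterexamples at stage [i], and their cluster point yields a contradiction. *)
Lemma compact_cluster {A : Type} {S : topologicalType} {K : set S}
    (I : set A) (B : A -> set S) : compact K -> I !=set0 ->
  (forall i k, I i -> I k -> exists2 l, I l & B l `<=` B i `&` B k) ->
  (forall i, I i -> (K `&` B i) !=set0) ->
  exists2 p, K p & forall i U, I i -> open U -> U p -> (K `&` B i `&` U) !=set0.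
Proof.
move=> cK I0 IB B0.
have FF : ProperFilter (filter_from I (fun i => K `&` B i)).
  apply: filter_from_proper => //; apply: filter_from_filter => // i k Ii Ik.
  have [l Il Bl] := IB i k Ii Ik; exists l => // p [Kp /Bl[]].
  by split; split.
have [|p [Kp clp]] := cK _ FF.
  by case: I0 => i Ii; exists i => // ? [].
exists p => // i U Ii oU Up; apply: clp; first by exists i.
exact: open_nbhs_nbhs.
Qed.

(** Otherwise the remainders [closure U \ V] cluster at a point [q] of [K] outside [V], which
    disjoint neighbourhoods of [p] and [q] exclude. *)
Lemma compact_hausdorff_on_regular {T : topologicalType} {K : set T} {p V} :
  compact K -> hausdorff_on K -> K p -> open V -> V p ->
  exists U, [/\ open U, U p & K `&` closure U `<=` V].
Proof.
move=> cK hK Kp oV Vp; apply: contrapT => nU.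
have [|U1 U2 [oU1 U1p] [oU2 U2p]|U [oU Up]|q Kq clq] :=
  @compact_cluster _ _ K [set U : set T | open U /\ U p]
    (fun U => closure U `\` V) cK.
- by exists setT; split=> //; exact: openT.
- exists (U1 `&` U2); first by split; [exact: openI | split].
  move=> q [/closureI[]]; by split; split.
- apply: contrapT => KU; apply: nU; exists U; split=> // q [Kq Uq].
  by apply: contrapT => Vq; apply: KU; exists q.
have Vq : ~ V q.
  move=> Vq; have [r [[_ [_ nVr]] Vr]] := clq V V (conj oV Vp) oV Vq; exact: nVr.
have [|U [W [oU oW Up Wq UW]]] := hK p q Kp Kq; first by move=> pq; rewrite -pq in Vq.
have [r [[_ [clr _]] Wr]] := clq U W (conj oU Up) oW Wq.
have [s UWs] : U `&` W !=set0 by apply: clr; exact: open_nbhs_nbhs.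
by rewrite UW in UWs.
Qed.

Lemma hausdorff_on_closure {T : topologicalType} {K : set T} {p q} :
  compact K -> hausdorff_on K -> K p -> K q -> p <> q ->
  exists U V, [/\ open U, open V, U p, V q & K `&` closure U `&` closure V = set0].
Proof.
move=> cK hK Kp Kq pq; have [U [V [oU oV Up Vq UV]]] := hK p q Kp Kq pq.
have [U' [oU' U'p U'U]] := compact_hausdorff_on_regular cK hK Kp oU Up.
have [V' [oV' V'p V'V]] := compact_hausdorff_on_regular cK hK Kq oV Vq.
exists U', V'; split=> //; rewrite -subset0 => r [[Kr ?] ?]; rewrite -UV.
by split; [apply: U'U | apply: V'V].
Qed.

(** The pair [(p, q)] lies in the closure of the graph of all [(i a, j a)]. Compactifications are
    compared through this relation instead of through nets. *)
Definition adherent {A : Type} {S T : topologicalType} (i : A -> S) (j : A -> T)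
    (p : S) (q : T) : Prop :=
  forall U V, open U -> open V -> U p -> V q -> exists a, U (i a) /\ V (j a).

Lemma adherentC {A : Type} {S T : topologicalType} {i : A -> S} {j : A -> T} {p q} :
  adherent i j p q -> adherent j i q p.
Proof. by move=> pq U V oU oV Uq Vp; have [a []] := pq V U oV oU Vp Uq; exists a. Qed.

Lemma adherent_diag {A : Type} {S T : topologicalType} (i : A -> S) (j : A -> T) a :
  adherent i j (i a) (j a).
Proof. by move=> *; exists a. Qed.

Lemma adherent_total {A : Type} {S T : topologicalType} {L : set T}
    {i : A -> S} {j : A -> T} {p} : compact L -> (forall a, L (j a)) ->
  closure (range i) p -> exists2 q, L q & adherent i j p q.
Proof.
move=> cL jL clp.
have [|U1 U2 [oU1 U1p] [oU2 U2p]|U [oU Up]|q Lq clq] :=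
  @compact_cluster _ _ L [set U : set S | open U /\ U p]
    (fun U => j @` (i @^-1` U)) cL.
- by exists setT; split=> //; exact: openT.
- exists (U1 `&` U2); first by split; [exact: openI | split].
  by move=> q [a [? ?] <-]; split; exists a.
- have [_ [[a _ <-] Ua]] := clp U (open_nbhs_nbhs (conj oU Up)).
  by exists (j a); split=> //; exists a.
exists q => // U V oU oV Up Vq.
by have [r [[_ [a Ua <-]] Vr]] := clq U V (conj oU Up) oV Vq; exists a.
Qed.

(** A closed graph argument: if [h] were discontinuous at [p], its values near [p] outside [V] would
    cluster at some [q]. Then [q] is adherent to [p], hence equal to [h p], which lies in [V]. *)
Lemma adherent_extension {A : Type} {S T : topologicalType} {K : set S} {L : set T}
    {i : A -> S} {j : A -> T} {h : S -> T} : compact L ->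
  (forall p, K p -> L (h p) /\ adherent i j p (h p)) ->
  (forall p q q', K p -> L q -> L q' ->
     adherent i j p q -> adherent i j p q' -> q = q') ->
  {within K, continuous h}.
Proof.
move=> cL hP uniq; apply/within_continuousP => p Kp V oV Vp.
apply: contrapT => nU.
have [|U1 U2 [oU1 U1p] [oU2 U2p]|U [oU Up]|q Lq clq] :=
  @compact_cluster _ _ L [set U : set S | open U /\ U p]
    (fun U => h @` (K `&` U) `\` V) cL.
- by exists setT; split=> //; exact: openT.
- exists (U1 `&` U2); first by split; [exact: openI | split].
  by move=> q [[a [? [? ?]] <-] ?]; split; split=> //; exists a.
- apply: contrapT => KU; apply: nU; exists U; split=> // q Kq Uq.
  apply: contrapT => Vq; apply: KU; exists (h q).
  by split; [exact: (hP q Kq).1 | split=> //; exists q].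
have hpq : h p = q.
  apply: (uniq p) => //; [exact: (hP p Kp).1|exact: (hP p Kp).2|].
  move=> U W oU oW Up Wq.
  have [_ [[_ [[p' [Kp' Up'] <-] _]] Wp']] := clq U W (conj oU Up) oW Wq.
  exact: (hP p' Kp').2.
have [r [[_ [_ nVr]] Vr]] : (L `&` (h @` (K `&` setT) `\` V) `&` V) !=set0.
  by apply: clq => //; [split=> //; exact: openT | rewrite -hpq].
exact: nVr.
Qed.

Lemma adherent_map {A : Type} {S T : topologicalType} {K : set S} {L : set T}
    {i : A -> S} {j : A -> T} : compact L -> (forall a, K (i a)) ->
    (forall a, L (j a)) ->  K `<=` closure (range i) -> [set: A] !=set0 ->
  (forall p q q', K p -> L q -> L q' ->
     adherent i j p q -> adherent i j p q' -> q = q') ->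
  exists h : S -> T, [/\ forall p, K p -> L (h p) /\ adherent i j p (h p),
    {within K, continuous h} & forall a, h (i a) = j a].
Proof.
move=> cL iK jL Kcl [a0 _] uniq.
have /choice[h hP] : forall p, exists q, K p -> L q /\ adherent i j p q.
  move=> p; have [Kp|nKp] := pselect (K p); last by exists (j a0).
  by have [q Lq pq] := adherent_total cL jL (Kcl p Kp); exists q.
exists h; split=> //; first exact: (adherent_extension cL hP uniq).
move=> a; have [? ?] := hP _ (iK a).
by apply: (uniq (i a)) => //; exact: adherent_diag.
Qed.

Lemma adherent_compactification_iso {A : Type} {S T : topologicalType}
    {K : set S} {L : set T} {i : A -> S} {j : A -> T} :
    compact K -> compact L -> (forall a, K (i a)) -> (forall a, L (j a)) ->
    K `<=` closure (range i) -> L `<=` closure (range j) -> [set: A] !=set0 ->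
    (forall p q q', K p -> L q -> L q' ->
       adherent i j p q -> adherent i j p q' -> q = q') ->
    (forall p p' q, K p -> K p' -> L q ->
       adherent i j p q -> adherent i j p' q -> p = p') ->
  compactification_iso K i L j.
Proof.
move=> cK cL iK jL Kcl Lcl A0 uniqL uniqK.
have [h [hP hc hi]] := adherent_map cL iK jL Kcl A0 uniqL.
have uniqK' q p p' : L q -> K p -> K p' ->
    adherent j i q p -> adherent j i q p' -> p = p'.
  by move=> ? ? ? /adherentC ? /adherentC ?; exact: (uniqK p p' q).
have [k [kP kc kj]] := adherent_map cK jL iK Lcl A0 uniqK'.
exists h, k; split=> //; split.
- by move=> p /hP[].
- by move=> q /kP[].
- move=> p Kp; have [Lhp php] := hP p Kp; have [Kkp kpp] := kP _ Lhp.
  by apply: (uniqK _ _ (h p)) => //; exact: adherentC.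
- move=> q Lq; have [Kkq qkq] := kP q Lq; have [Lhq hqq] := hP _ Kkq.
  by apply: (uniqL (k q)) => //; exact: adherentC.
Qed.

(* Grothendieck's double limit: both iterated limits of [mul (x m) (y n)] are
   the product of cluster points of [x] and of [y]. *)
Lemma double_limit {T : topologicalType} {K : set T} {mul : T -> T -> T}
    {V1 V2 : set T} (x y : nat -> T) : compact K ->
    (forall a b, K a -> K b -> K (mul a b)) ->
    (forall a, K a -> {within K, continuous (mul a)} /\
                      {within K, continuous (fun b => mul b a)}) ->
    (forall n, K (x n)) -> (forall n, K (y n)) ->
    (forall m n, (n <= m)%N -> V1 (mul (x m) (y n))) ->
    (forall m n, (m < n)%N -> V2 (mul (x m) (y n))) ->
  (K `&` closure V1 `&` closure V2) !=set0.
Proof.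
move=> cK mulK mulc xK yK V1xy V2xy.
have cl (z : nat -> T) : (forall n, K (z n)) -> exists2 p, K p &
    forall n U, open U -> U p -> exists2 m, (n <= m)%N & U (z m).
  move=> zK.
  have [|i k _ _|n _|p Kp clp] := @compact_cluster _ _ K [set: nat]
    (fun n => z @` [set m | (n <= m)%N]) cK.
  - by exists 0%N.
  - exists (maxn i k) => // _ [m /= + <-]; rewrite geq_max => /andP[? ?].
    by split; exists m.
  - by exists (z n); split=> //; exists n => /=.
  exists p => // n U oU Up.
  by have [_ [[_ [m nm <-]] Um]] := clp n U I oU Up; exists m.
have [p Kp px] := cl x xK; have [q Kq qy] := cl y yK.
exists (mul p q); split; [split; first exact: mulK|].
(* First [y n] approaches [q], then, for this [n], some [x m] with [n <= m] approaches [p]. Each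
   approach costs one closure. *)
- apply: (@closed_closure _ V1).
  move=> U /=; rewrite nbhsE => -[U' [oU' U'pq] U'U].
  have [W [oW Wq WU]] := (within_continuousP.1 (mulc p Kp).1) q Kq U' oU' U'pq.
  have [n _ Wn] := qy 0%N W oW Wq; exists (mul p (y n)).
  split; last by apply: U'U; apply: WU.
  move=> O; rewrite nbhsE => -[O' [oO' O'p] O'O].
  have [Z [oZ Zp ZO]] := (within_continuousP.1 (mulc _ (yK n)).2) p Kp O' oO' O'p.
  have [m nm Zm] := px n Z oZ Zp; exists (mul (x m) (y n)).
  by split; [exact: V1xy | apply: O'O; apply: ZO].
(* The order is reversed: [x n] is fixed near [p] first, and the index of [y] is taken from [n.+1]
   on to make it strictly larger. *)
- apply: (@closed_closure _ V2).
  move=> U /=; rewrite nbhsE => -[U' [oU' U'pq] U'U].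
  have [W [oW Wq WU]] := (within_continuousP.1 (mulc q Kq).2) p Kp U' oU' U'pq.
  have [n _ Wn] := px 0%N W oW Wq; exists (mul (x n) q).
  split; last by apply: U'U; apply: WU.
  move=> O; rewrite nbhsE => -[O' [oO' O'p] O'O].
  have [Z [oZ Zp ZO]] := (within_continuousP.1 (mulc _ (xK n)).1) q Kq O' oO' O'p.
  have [m nm Zm] := qy n.+1 Z oZ Zp; exists (mul (x n) (y m)).
  by split; [exact: V2xy | apply: O'O; apply: ZO].
Qed.

(** * Permutations extending finite partial injections *)

Definition sp_V {X : Type} (g : sperm X) : sperm X := SPerm (sp_invK g) (sp_funK g).

Lemma sp_injective {X : Type} (g : sperm X) : injective g.
Proof. exact: can_inj (sp_funK g). Qed.

Definition swap_fun {X : eqType} (x y z : X) : X :=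
  if z == x then y else if z == y then x else z.

Lemma swap_funK {X : eqType} (x y : X) : cancel (swap_fun x y) (swap_fun x y).
Proof.
move=> z; rewrite /swap_fun; case: (z =P x) => [->|zx].
  by case: (y =P x) => // _; rewrite eqxx.
case: (z =P y) => [->|zy]; first by rewrite eqxx.
by case: eqP => // _; case: eqP.
Qed.

Definition swap {X : eqType} (x y : X) : sperm X :=
  SPerm (swap_funK x y) (swap_funK x y).

Lemma swapL {X : eqType} (x y : X) : swap x y x = y.
Proof. by rewrite /= /swap_fun eqxx. Qed.

Lemma swap_out {X : eqType} (x y z : X) : z <> x -> z <> y -> swap x y z = z.
Proof. by move=> /eqP/negbTE zx /eqP/negbTE zy; rewrite /= /swap_fun zx zy. Qed.

Definition finitary {X : Type} (g : sperm X) : Prop :=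
  exists S, finite_set S /\ fixes (~` S) g.

Lemma infinite_fresh {X : Type} {C : set X} :
  infinite_set [set: X] -> finite_set C -> exists x, ~ C x.
Proof.
move=> X_inf Cfin; apply: contrapT => nC; apply: X_inf.
by apply: sub_finite_set Cfin => x _; apply: contrapT => Cx; apply: nC; exists x.
Qed.

(** Induction on a list of the points of [F], correcting the permutation by one transposition per
    new point. Points where [f] is undefined go to fresh values outside [C]. *)
Lemma partial_injection_extension {X : choiceType} {F C : set X}
    (f : X -> option X) : infinite_set [set: X] -> finite_set F -> finite_set C ->
    (forall x x' y, F x -> F x' -> f x = Some y -> f x' = Some y -> x = x') ->
  exists h : sperm X, finitary h /\
    forall x, F x -> if f x is Some y then h x = y else ~ C (h x).
Proof.
move=> X_inf /finite_seqP[s ->] Cfin finj.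
(* Fresh values must also avoid all prescribed ones, including those not yet treated. *)
pose C' := C `|` [set y | exists2 x, x \in s & f x = Some y].
have C'fin : finite_set C'.
  rewrite finite_setU; split=> //.
  apply: sub_finite_set (finite_seq (pmap f s)) => y [x xs fx] /=.
  by rewrite mem_pmap -fx map_f.
suff [h [hfin hf]] : exists h : sperm X, finitary h /\
    forall x, x \in s -> if f x is Some y then h x = y else ~ C' (h x).
  exists h; split=> // x xs; have := hf x xs; case: (f x) => // nC Chx.
  by apply: nC; left.
(* The induction runs over sublists [l] of [s], so that [finj] and [C'] remain those of the whole
   list. *)
have : {subset s <= s} by [].
elim: {-2}s => [|x l IHl] ls.
  by exists (sp_one X); split=> //; exists set0; split=> //; exact: finite_set0.
have [|h [[S [Sfin hS]] hf]] := IHl.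
  by move=> a al; apply: ls; rewrite inE al orbT.
have [xl|xl] := boolP (x \in l).
  by exists h; split; [exists S | move=> a; rewrite inE => /predU1P[->|]; exact: hf].
have [z zD] : exists z, ~ (C' `|` h @` [set` l]) z.
  apply: infinite_fresh X_inf _; rewrite finite_setU; split=> //.
  by apply: finite_image; exact: finite_seq.
pose t := if f x is Some y then y else z.
have th a : a \in l -> h a <> t.
  move=> al; rewrite /t; case fx: (f x) => [y|] hay.
    have := hf a al; case fa: (f a) => [y'|].
      move=> hay'; move/negP: xl; apply; rewrite (finj x a y) //.
      - by apply: ls; rewrite inE eqxx.
      - by apply: ls; rewrite inE al orbT.
      - by rewrite fa -hay' hay.
    apply; rewrite hay; right; exists x => //; apply: ls; by rewrite inE eqxx.
  by apply: zD; right; exists a.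
exists (sp_mul (swap (h x) t) h); split.
  exists (S `|` [set h x; t]); split.
    by rewrite finite_setU; split=> //; exact: finite_set2.
  move=> a /= /not_orP[Sa /not_orP[ahx at_]].
  have ha : h a = a by exact: hS.
  by rewrite ha; exact: swap_out.
move=> a; rewrite inE => /predU1P[->|al].
  have -> : sp_mul (swap (h x) t) h x = t by exact: swapL.
  rewrite /t; case: (f x) => // C'z; apply: zD; by left.
have -> : sp_mul (swap (h x) t) h a = h a.
  apply: swap_out; last exact: th.
  by move=> hax; move: xl; rewrite -(sp_injective _ _ _ hax) al.
exact: hf.
Qed.

Lemma injection_extension {X : choiceType} {F : set X} {t : X -> X} :
    infinite_set [set: X] -> finite_set F ->
    (forall x x', F x -> F x' -> t x = t x' -> x = x') ->
  exists h : sperm X, finitary h /\ forall x, F x -> h x = t x.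
Proof.
move=> X_inf Ffin tinj.
have [x x' y Fx Fx' [<-] [/esym]|h [? hF]] :=
  partial_injection_extension (Some \o t) X_inf Ffin (finite_set0 X).
  exact: tinj.
by exists h.
Qed.

(** * The one-point compactification *)

Section AlphaTopology.
Context {X : choiceType}.
Implicit Types (x : X) (C : set X) (V : set (alphaX X)).

Lemma alpha_open_some x : open [set (Some x : alphaX X)].
Proof.
rewrite -(image_set1 Some x).
by apply: (@one_point_compactification_open_some (discrete_topology X));
  exact: discrete_open.
Qed.

(** If [W] were infinite, the complements of finite sets would cluster at some [x] in [W], but the
    open set of [x] alone is finite. *)
Lemma compact_discrete_finite (W : set (discrete_topology X)) :
  compact W -> finite_set W.
Proof.
move=> cW; apply: contrapT => Winf.
have [|C D Cfin Dfin|C Cfin|x Wx clx] := @compact_cluster (set X) _ W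
   (fun C : set X => finite_set C) (fun C => ~` C) cW.
- by exists set0; exact: finite_set0.
- exists (C `|` D); first by rewrite finite_setU.
  by move=> x /not_orP[].
- apply: contrapT => WC; apply: Winf; apply: sub_finite_set Cfin => x Wx.
  by apply: contrapT => Cx; apply: WC; exists x.
have [y [[_ yx] xy]] := clx [set x] [set x] (finite_set1 x) (discrete_open _) erefl.
exact: yx.
Qed.

Lemma alpha_nbhs_none V :
  nbhs (None : alphaX X) V <-> V None /\ finite_set [set x | ~ V (Some x)].
Proof.
split=> [[W [cW _]] WV|[VN Vfin]].
  split; first by apply: WV; right.
  apply: sub_finite_set (compact_discrete_finite _ cW) => x Vx.
  by apply: contrapT => Wx; apply: Vx; apply: WV; left; exists x.
exists [set x | ~ V (Some x)].
  split; last exact: discrete_closed.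
  exact: (@finite_compact (discrete_topology X)).
move=> p [[x /= /contrapT Vx <-] //|-> //].
Qed.

Lemma alpha_open V :
  open V <-> (V None -> finite_set [set x | ~ V (Some x)]).
Proof.
split=> [oV VN|Vfin].
  by have [] := (alpha_nbhs_none V).1 (open_nbhs_nbhs (conj oV VN)).
rewrite openE => -[x|] Vx; last by apply/alpha_nbhs_none; split=> //; exact: Vfin.
rewrite /interior nbhsE; exists [set (Some x : alphaX X)]; last by move=> p ->.
by split=> //; exact: alpha_open_some.
Qed.

Lemma alpha_hausdorff : hausdorff_space (alphaX X).
Proof.
have sep x (q : alphaX X) : Some x <> q -> exists U V : set (alphaX X),
    [/\ open U, open V, U (Some x), V q & U `&` V = set0].
  move=> xq; exists [set Some x], (~` [set Some x]); split=> //.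
  - exact: alpha_open_some.
  - apply/alpha_open => _; apply: sub_finite_set (finite_set1 x) => y /=.
    by move/contrapT => -[].
  - exact/nesym.
  - by rewrite setICr.
rewrite open_hausdorff => -[x|] q /eqP.
  move=> /sep[U [V [oU oV Ux Vq UV]]]; exists (U, V); first by split; exact/mem_set.
  by split=> //; exact/eqP.
case: q => [y|//] /nesym/sep[U [V [oU oV Ux Vq UV]]].
exists (V, U); first by split; exact/mem_set.
by split=> //; rewrite setIC; exact/eqP.
Qed.

Lemma alpha_closure_range :
  infinite_set [set: X] -> [set: alphaX X] `<=` closure (range (@alpha_emb X)).
Proof.
move=> X_inf -[x|] _ V Vp; first by exists (Some x); split; [exists x | exact: (nbhs_singleton Vp)].
have [_ Vfin] := (alpha_nbhs_none V).1 Vp.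
have [x /contrapT Vx] := infinite_fresh X_inf Vfin.
by exists (Some x); split=> //; exists x.
Qed.

End AlphaTopology.

Lemma hausdorff_space_on {T : topologicalType} {K : set T} :
  hausdorff_space T -> hausdorff_on K.
Proof.
rewrite open_hausdorff => hT p q _ _ /eqP/hT[[U V] /= [/set_mem Up /set_mem Vq]].
by move=> [oU oV /eqP UV]; exists U, V.
Qed.

Lemma alpha_compactification {X : choiceType} : infinite_set [set: X] ->
  compactification_in (fun _ : set X => True) [set: alphaX X] (@alpha_emb X).
Proof.
move=> X_inf; split=> //.
- split; first exact: one_point_compactification_compact.
  exact/hausdorff_space_on/alpha_hausdorff.
- by split=> //; exact: alpha_closure_range.
- move=> U _; exists (Some @` U); split.
    apply: (@one_point_compactification_open_some (discrete_topology X)).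
    exact: discrete_open.
  by apply/seteqP; split=> x; [move=> Ux; exists x | move=> [y Uy [<-]]].
Qed.

(** This is the uniformity induced on [X] by its one-point compactification. *)
Definition cofinite_ent {X : Type} (E : set (X * X)) : Prop :=
  exists F : set X, finite_set F /\
    forall x y, x = y \/ (~ F x /\ ~ F y) -> E (x, y).

Lemma cofinite_equiuniformity {X : Type} : equiuniformity (@cofinite_ent X).
Proof.
split.
- split.
  + split; first by exists set0; split=> //; exact: finite_set0.
    by move=> E D [F [Ffin FE]] ED; exists F; split=> // x y xy; apply: ED; exact: FE.
  + move=> E D [F [Ffin FE]] [F' [F'fin F'D]].
    exists (F `|` F'); split; first by rewrite finite_setU.
    move=> x y xy; split; [apply: FE | apply: F'D];
      case: xy => [xy|[/not_orP[? ?] /not_orP[? ?]]]; by [left | right].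
  + by move=> E [F [Ffin FE]] a; apply: FE; left.
  + move=> E [F [Ffin FE]]; exists F; split=> // x y xy; apply: FE.
    by case: xy => [->|[? ?]]; [left | right].
  + move=> E [F [Ffin FE]].
    exists [set xy | xy.1 = xy.2 \/ (~ F xy.1 /\ ~ F xy.2)]; split; first by exists F.
    by move=> a b c /= [->|[Fa Fb]] [<-|[Fb' Fc]]; apply: FE; [left|right|right|right].
- move=> g E [F [Ffin FE]].
  exists [set xy | E (g xy.1, g xy.2)]; split=> //.
  exists (sp_inv g @` F); split; first exact: finite_image.
  move=> x y [->|[gx gy]]; apply: FE; [by left | right].
  by split=> Fg; [apply: gx | apply: gy]; eexists; try exact: Fg; exact: sp_funK.
- move=> E [F [Ffin FE]]; exists F; split=> // g gF x; apply: FE.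
  have [Fx|nFx] := pselect (F x); first by left; rewrite gF.
  right; split=> // Fgx; apply: nFx; rewrite -(sp_injective g (g x) x) //.
  exact: gF.
Qed.

Lemma alpha_G_compactification {X : choiceType} : infinite_set [set: X] ->
  G_compactification [set: alphaX X] (@alpha_emb X).
Proof.
move=> X_inf; exists cofinite_ent; split.
- exact: cofinite_equiuniformity.
(* One point [x0] outside [F] serves as centre for the whole complement of [F]. *)
- move=> E [F [Ffin FE]]; have [x0 Fx0] := infinite_fresh X_inf Ffin.
  exists (F `|` [set x0]); split.
    by rewrite finite_setU; split=> //; exact: finite_set1.
  move=> a; have [Fa|nFa] := pselect (F a).
    by exists a; split; [left | apply: FE; left].
  by exists x0; split; [right | apply: FE; right].
- split; first exact: alpha_compactification.
    move=> W Wdiag.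
    have [U [oU UN UW]] := Wdiag None I.
    exists [set x | ~ U (Some x)]; split; first exact: (alpha_open U).1.
    move=> x y [->|[/= /contrapT Ux /contrapT Uy]]; last exact: UW.
    by have [V [_ Vy VW]] := Wdiag (Some y) I; exact: VW.
  move=> E [F [Ffin FE]].
  pose W := [set pq : alphaX X * alphaX X | pq.1 = pq.2 \/
    ((forall x, F x -> pq.1 <> Some x) /\ (forall x, F x -> pq.2 <> Some x))].
  exists W; split; last first.
    move=> a b [[->]|[/= Fa Fb]]; apply: FE; [by left | right].
    by split=> [/Fa|/Fb]; exact.
  move=> -[x|] _.
    exists [set Some x]; split=> //; first exact: alpha_open_some.
    by move=> p q _ _ -> ->; left.
  exists [set p | forall x, F x -> p <> Some x]; split=> //.
    apply/alpha_open => _; apply: sub_finite_set Ffin => x /= nF.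
    by apply: contrapT => Fx; apply: nF => y Fy [xy]; rewrite xy in Fx.
  by move=> p q _ _ Fp Fq; right.
Qed.

(* A transposition of two points outside [F] fixes [F], so they are [E]-related. *)
Lemma equiuniformity_cofinite {X : eqType} {ent : set (X * X) -> Prop} {E} :
  equiuniformity ent -> ent E -> cofinite_ent E.
Proof.
move=> [[_ _ refl _ _] _ bdd] entE; have [F [Ffin FE]] := bdd E entE.
exists F; split=> // x y [->|[Fx Fy]]; first exact: refl.
rewrite -[y in E (x, y)](swapL x y); apply: FE => z Fz.
by apply: swap_out => zx; [move: Fx | move: Fy]; rewrite -zx.
Qed.

(** Points of [X] are isolated on both sides, so [Some x] is matched with [j x] only. The remaining
    points of [K] all lie over [None], and they coincide because an entourage separating two of them
    would have to relate all points of [X] outside a finite set. *)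
Lemma G_compactification_unique {X : choiceType} {T : topologicalType} {K : set T}
    {j : X -> T} : infinite_set [set: X] -> G_compactification K j ->
  compactification_iso K j [set: alphaX X] (@alpha_emb X).
Proof.
move=> X_inf [ent [equi _ [[[cK hK] [jK Kcl] _ jinj jemb] Went _]]].
have [[_ hA] [_ Acl] _ _ _] := alpha_compactification X_inf.
have adh_some p x : K p -> adherent j (@alpha_emb X) p (Some x) -> p = j x.
  move=> Kp px; apply: contrapT => /(hK p (j x) Kp (jK x))[U [V [oU oV Up Vx UV]]].
  have [a [Ua [ax]]] := px U [set Some x] oU (alpha_open_some x) Up erefl.
  have : (U `&` V) (j x) by split=> //; rewrite -ax.
  by rewrite UV.
have adh_none p x : adherent j (@alpha_emb X) p None -> p <> j x.
  move=> pN pjx; have [V [oV Vx]] := jemb [set x] I.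
  have [|||a [Va ax]] := pN V (~` [set Some x]) oV.
  - by apply/alpha_open => _; apply: sub_finite_set (finite_set1 x) => y /= /contrapT[].
  - by rewrite pjx -[V _]/((j @^-1` V) x) -Vx.
  - by [].
  by apply: ax; rewrite /alpha_emb; congr Some; move: Va; rewrite -[V _]/((j @^-1` V) a) -Vx.
apply: adherent_compactification_iso => //.
- exact: one_point_compactification_compact.
- by have [x _] := infinite_setN0 X_inf; exists x.
- move=> p [x|] [y|] Kp _ _ //.
  + by move=> /(adh_some _ _ Kp) -> /(adh_some _ _ (jK x))/jinj ->.
  + by move=> /(adh_some _ _ Kp) px /adh_none/(_ px).
  + by move=> /adh_none pN /(adh_some _ _ Kp)/pN.
move=> p p' [x|] Kp Kp' _.
  by move=> /(adh_some _ _ Kp) -> /(adh_some _ _ Kp').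
move=> pN p'N; apply: contrapT => pp'.
have [O [V [oO oV Op Vp' OV]]] := hK p p' Kp Kp' pp'.
have [U [oU Up UO]] := compact_hausdorff_on_regular cK hK Kp oO Op.
(* On [K] the closure of [U] lies in [O], so [O] and the complement of that closure cover [K]. Yet
   [W] relates no point of [U] to a point outside [O]. *)
pose W := [set qr : T * T | (O qr.1 /\ O qr.2) \/ (~ closure U qr.1 /\ ~ closure U qr.2)].
have /Went/(equiuniformity_cofinite equi)[F [Ffin FW]] : diag_nbhd K W.
  move=> q Kq; have [Uq|nUq] := pselect (closure U q).
    by exists O; split=> //; [exact: UO | move=> *; left].
  exists (~` closure U); split=> //; last by move=> *; right.
  by apply: closed_openC; exact: closed_closure.
have farF : open [set q : alphaX X | forall x, F x -> q <> Some x].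
  apply/alpha_open => _; apply: sub_finite_set Ffin => x /= nF.
  by apply: contrapT => Fx; apply: nF => y Fy [xy]; rewrite xy in Fx.
have [//|x [Ux Fx]] := pN U _ oU farF Up.
have [//|y [Vy Fy]] := p'N V _ oV farF Vp'.
have : W (j x, j y).
  by apply: FW; right; split=> [/Fx|/Fy]; exact.
case=> /= [[_ Oy]|[Ux' _]]; last by apply: Ux'; exact: subset_closure.
have : (O `&` V) (j y) by [].
by rewrite OV.
Qed.

(** * The space of partial injections *)

(** The set [Y] is forced to be the set of points whose value is not [None], so it can be
    eliminated. *)
Lemma brXP {X : choiceType} {f : selfmaps X} : brX X f <-> f None = None /\
  forall x1 x2 y, f (Some x1) = Some y -> f (Some x2) = Some y -> x1 = x2.
Proof.
split=> [[Y [fY Yinj nY]]|[fN finj]].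
  have inY x y : f (Some x) = Some y -> Y x.
    move=> fx; apply: contrapT => Yx; move: fx; rewrite nY //.
    by move=> [z [Yz [xz]]]; rewrite xz in Yx.
  split=> [|x1 x2 y f1 f2]; first by apply: nY => -[y []].
  by apply: Yinj; rewrite ?f1 ?f2 //; exact: inY (y) _.
exists [set x | exists y, f (Some x) = Some y]; split=> //.
  by move=> x1 x2 [y1 f1] [y2 f2]; rewrite f1 => f12; apply: finj f1 _; rewrite f12.
move=> [x|] nx //; case fx: (f (Some x)) => [y|] //.
by case: nx; exists x; split=> //; exists y.
Qed.

Lemma brX_ext {X : choiceType} {f h : selfmaps X} : brX X f -> brX X h ->
  (forall x y, f (Some x) = Some y <-> h (Some x) = Some y) -> f = h.
Proof.
move=> /brXP[fN _] /brXP[hN _] fh; apply/funext => -[x|]; last by rewrite fN hN.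
case fx: (f (Some x)) => [y|]; first exact/esym/fh.
by case hx: (h (Some x)) => [y|] //; rewrite -fx; apply/fh.
Qed.

(** Values outside [F] are not told apart from each other or from [None]; this is what makes such
    patterns neighbourhoods in [alphaX X]. *)
Definition agree {X : choiceType} (F : set X) (f h : selfmaps X) : Prop :=
  forall x y, F x -> F y -> (f (Some x) = Some y <-> h (Some x) = Some y).

Lemma open_finite_bigcap {T : topologicalType} {I : choiceType} (D : set I)
    (U : I -> set T) : finite_set D -> (forall i, D i -> open (U i)) ->
  open [set x | forall i, D i -> U i x].
Proof.
move=> Dfin oU.
rewrite (_ : [set _ | _] = ~` \bigcup_(i in D) (~` U i)); last first.
  apply/seteqP; split=> [x Ux [i Di]|x nU i Di]; first by apply; exact: Ux.
  by apply: contrapT => Uix; apply: nU; exists i.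
apply: closed_openC; apply: closed_bigcup => //.
by move=> i Di; apply: open_closedC; exact: oU.
Qed.

Section Agree.
Context {X : choiceType}.
Implicit Types (F : set X) (f h : selfmaps X) (g : sperm X).

Lemma agree_refl F f : agree F f f.
Proof. by []. Qed.

Lemma agree_sym {F f h} : agree F f h -> agree F h f.
Proof. by move=> fh x y Fx Fy; apply: iff_sym; exact: fh. Qed.

Lemma agree_trans {F f1 f2 f3} : agree F f1 f2 -> agree F f2 f3 -> agree F f1 f3.
Proof. by move=> c12 c23 x y Fx Fy; apply: iff_trans (c12 x y Fx Fy) (c23 x y Fx Fy). Qed.

Lemma agreeS {F F' f h} : F `<=` F' -> agree F' f h -> agree F f h.
Proof. by move=> FF' c x y /FF' Fx /FF' Fy; exact: c. Qed.

Lemma agree_emb {F f g x y} : agree F f (ellis_emb g) -> F x -> F y ->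
  f (Some x) = Some y <-> g x = y.
Proof.
move=> c Fx Fy; apply: iff_trans (c x y Fx Fy) _.
by split=> [[]|<-].
Qed.

Lemma ellis_emb_brX g : brX X (ellis_emb g).
Proof. by apply/brXP; split=> // x1 x2 y [<-] [hx]; exact/esym/(sp_injective g). Qed.

Lemma ellis_emb_inj : injective (@ellis_emb X).
Proof.
move=> [g g' gK g'K] [h h' hK h'K] gh.
have gh1 : g = h.
  apply/funext => x; have := congr1 (fun f : selfmaps X => f (Some x)) gh.
  by rewrite /ellis_emb /= => -[].
move: h' hK h'K gh; rewrite -gh1 => h' hK h'K _.
have gh' : g' = h' by apply/funext => x; rewrite -{1}(h'K x) gK.
move: hK h'K; rewrite -gh' => hK h'K.
by congr SPerm; exact: Prop_irrelevance.
Qed.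

Lemma brX_approx {F f} : infinite_set [set: X] -> finite_set F -> brX X f ->
  exists g, finitary g /\ agree F f (ellis_emb g).
Proof.
move=> X_inf Ffin /brXP[_ finj].
(* With [C] equal to [F], the points sent to [None] by [f] leave [F], so they add no pair to the
   pattern. *)
have [x x' y _ _|g [gfin gf]] :=
  partial_injection_extension (fun x => f (Some x)) X_inf Ffin Ffin.
  exact: finj.
exists g; split=> // x y Fx Fy; have := gf x Fx; rewrite /ellis_emb /=.
case: (f (Some x)) => [z ->|gxF] //.
by split=> // -[gxy]; rewrite gxy in gxF.
Qed.

Lemma eval_continuous (p : alphaX X) : continuous (fun f : selfmaps X => f p).
Proof. exact: (@proj_continuous _ (fun _ : alphaX X => alphaX X) p). Qed.

Lemma agree_open {F f} : finite_set F -> open (agree F f).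
Proof.
move=> Ffin.
pose U (xy : X * X) := [set h : selfmaps X |
  f (Some xy.1) = Some xy.2 <-> h (Some xy.1) = Some xy.2].
rewrite (_ : agree F f = [set h | forall xy, (F `*` F) xy -> U xy h]); last first.
  apply/seteqP; split=> h c; first by move=> [x y] [/= Fx Fy]; exact: c.
  by move=> x y Fx Fy; exact: (c (x, y)).
apply: open_finite_bigcap; first exact: finite_setX.
move=> [x y] _; rewrite /U /=.
have ev (V : set (alphaX X)) : open V -> open [set h : selfmaps X | V (h (Some x))].
  by move=> oV; apply: open_comp => // h _; exact: eval_continuous.
have [fxy|fxy] := pselect (f (Some x) = Some y).
  rewrite (_ : [set _ | _] = [set h : selfmaps X | [set Some y] (h (Some x))]).
    by apply: ev; exact: alpha_open_some.
  by apply/seteqP; split=> h /=; [move=> [hxy _]; exact: hxy | split].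
rewrite (_ : [set _ | _] = [set h : selfmaps X | (~` [set Some y]) (h (Some x))]).
  apply: ev; apply/alpha_open => _; apply: sub_finite_set (finite_set1 y) => z /=.
  by move/contrapT => -[].
by apply/seteqP; split=> h /=; [move=> [_ hxy] /hxy | split].
Qed.

(** Patterns on finite sets give a neighbourhood base at [f] among the maps fixing [None]; the
    product topology lets this be checked one coordinate at a time. *)
Lemma open_agree {f} {V : set (selfmaps X)} : f None = None -> open V -> V f ->
  exists F, finite_set F /\ forall h, h None = None -> agree F f h -> V h.
Proof.
move=> fN oV Vf.
pose G := filter_from (fun F : set X => finite_set F)
  (fun F => [set h : selfmaps X | h None = None /\ agree F f h]).
have GF : Filter G.
  apply: filter_from_filter; first by exists set0; exact: finite_set0.
  move=> F F' Ffin F'fin; exists (F `|` F'); first by rewrite finite_setU.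
  by move=> h [hN c]; split; split=> //; apply: agreeS c => x; [left | right].
have Gf : G --> f.
  apply/cvg_sup => p W [_ [[V' oV' <-] V'f] V'W].
  rewrite nbhs_simpl; apply: (@filterS _ G _ ((fun h : selfmaps X => h p) @^-1` V')) => //.
  move: V'f => /=; case: p {V'W} => [x|].
    case fx: (f (Some x)) => [y|] V'f.
      exists [set x; y]; first exact: finite_set2.
      by move=> h /= [_ c]; rewrite ((c x y _ _).1 fx) //; [left | right].
    (* Here [f] sends [x] to [None], and [V'] misses only finitely many points of [X]. Including
       them in the pattern prevents [h] from sending [x] to any of them. *)
    have Cfin := (alpha_open V').1 oV' V'f.
    exists ([set x] `|` [set z | ~ V' (Some z)]).
      by rewrite finite_setU; split=> //; exact: finite_set1.
    move=> h /= [_ c]; case hx: (h (Some x)) => [z|] //.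
    apply: contrapT => V'z; suff : f (Some x) = Some z by rewrite fx.
    by apply/c => //; [left | right].
  rewrite fN => V'N; exists set0; first exact: finite_set0.
  by move=> h /= [-> _].
have [F Ffin FV] : G V by apply: Gf; apply: open_nbhs_nbhs.
by exists F; split=> // h hN c; apply: FV.
Qed.

Lemma brX_open {f} {V : set (selfmaps X)} : brX X f -> open V -> V f ->
  exists F, finite_set F /\ forall h, brX X h -> agree F f h -> V h.
Proof.
move=> /brXP[fN _] oV Vf; have [F [Ffin FV]] := open_agree fN oV Vf.
by exists F; split=> // h /brXP[hN _]; exact: FV.
Qed.

(** Injectivity is a condition on patterns over three points, hence passes to the closure;
    conversely every finite pattern comes from a permutation. *)
Lemma ellis_spaceE : infinite_set [set: X] -> ellis_space X = brX X.
Proof.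
move=> X_inf; apply/seteqP; split=> f.
  move=> clf; apply/brXP; split.
    case fN: (f None) => [y|] //.
    have [_ [[g _ <-] //]] : (range (@ellis_emb X) `&`
        [set h : selfmaps X | [set Some y] (h None)]) !=set0.
    apply: clf; apply: open_nbhs_nbhs; split=> //.
    apply: open_comp => [h _|]; [exact: eval_continuous | exact: alpha_open_some].
  move=> x1 x2 y f1 f2; pose F := [set x1; x2; y].
  have [_ [[g _ <-] c]] : (range (@ellis_emb X) `&` agree F f) !=set0.
    apply: clf; apply: open_nbhs_nbhs; split=> //; apply: agree_open.
    exact: finite_set3.
  have g1 : g x1 = y by apply/(agree_emb c) => //; [left; left | right].
  have g2 : g x2 = y by apply/(agree_emb c) => //; [left; right | right].
  by apply: (sp_injective g); rewrite g1 g2.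
move=> fbr V; rewrite nbhsE => -[U [oU Uf] UV].
have [F [Ffin FU]] := brX_open fbr oU Uf.
have [g [_ c]] := brX_approx X_inf Ffin fbr.
exists (ellis_emb g); split; first by exists g.
by apply: UV; apply: FU => //; exact: ellis_emb_brX.
Qed.

Lemma brX_compact : infinite_set [set: X] -> compact (brX X).
Proof.
move=> X_inf; rewrite -ellis_spaceE //.
apply: (@subclosed_compact _ _ setT); [exact: closed_closure | | by []].
have := @tychonoff (alphaX X) (fun _ => alphaX X) (fun _ => setT)
  (fun _ => one_point_compactification_compact).
by congr compact; apply/seteqP; split.
Qed.

Lemma selfmaps_hausdorff : hausdorff_space (selfmaps X).
Proof.
exact: (@hausdorff_product _ (fun _ : alphaX X => alphaX X) (fun _ => alpha_hausdorff)).
Qed.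

Lemma sp_open_preimage (V : set (selfmaps X)) : open V -> sp_open (@ellis_emb X @^-1` V).
Proof.
move=> oV g Vg; have [F [Ffin FV]] := brX_open (ellis_emb_brX g) oV Vg.
exists F; split=> // h hg; apply: FV; first exact: ellis_emb_brX.
by move=> x y Fx Fy; rewrite /ellis_emb /= hg.
Qed.

Lemma brX_compactification : infinite_set [set: X] ->
  compactification_in (@sp_open X) (brX X) (@ellis_emb X).
Proof.
move=> X_inf; split.
- split; first exact: brX_compact.
  exact/hausdorff_space_on/selfmaps_hausdorff.
- by split=> [g|]; [exact: ellis_emb_brX | rewrite -ellis_spaceE].
- exact: sp_open_preimage.
- exact: ellis_emb_inj.
move=> U oU.
exists [set f | exists F g, [/\ finite_set F,
  forall h : sperm X, (forall x, F x -> h x = g x) -> U h &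
  forall x, F x -> f (Some x) = Some (g x)]]; split; last first.
  apply/seteqP; split=> g; last first.
    by move=> [F [h [_ hU gh]]]; apply: hU => x /gh [].
  by move=> /oU[F [Ffin FU]]; exists F, g; split.
rewrite openE => f [F [g [Ffin FU fg]]]; rewrite /interior nbhsE.
(* The pattern must see the pairs [(x, g x)], hence the image of [F] is added. *)
exists (agree (F `|` g @` F) f).
  split=> //; apply: agree_open.
  by rewrite finite_setU; split=> //; exact: finite_image.
move=> h c; exists F, g; split=> // x Fx.
apply/(c x (g x)); [by left | by right; exists x | exact: fg].
Qed.

(** Multiplying by stabilisers of [F] on either side preserves the pattern. Conversely, one seeks
    [b] fixing [F] such that [h b g^-1] fixes [F] too; then [h] is the product of [h b g^-1], [g]
    and [b^-1]. *)
Lemma roelcke_baseP {F} {g h : sperm X} : infinite_set [set: X] -> finite_set F ->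
  roelcke_base F (g, h) <-> agree F (ellis_emb g) (ellis_emb h).
Proof.
move=> X_inf Ffin; split.
  move=> [a [b [aF bF /= hE]]] x y Fx Fy; rewrite /ellis_emb /= hE bF //.
  split=> -[]; first by move=> ->; rewrite aF.
  by move=> agx; congr Some; apply: (sp_injective a); rewrite agx aF.
move=> c.
have cE x y : F x -> F y -> g x = y <-> h x = y.
  by move=> Fx Fy; have [c1 c2] := c x y Fx Fy; split=> E;
    [move: c1 | move: c2]; rewrite /ellis_emb /= E => /(_ erefl) [].
(* [b] fixes [F] and maps [g^-1 z] to [h^-1 z] for [z] in [F]. *)
pose t y := if pselect (F y) then y else sp_inv h (g y).
have tF y : F y -> t y = y by rewrite /t; case: pselect.
have tg y : F (g y) -> t y = sp_inv h (g y).
  rewrite /t; case: pselect => // Fy Fgy.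
  by rewrite -[LHS](sp_funK h); congr (sp_inv h); apply/cE.
have [||b [_ bt]] := @injection_extension X (F `|` sp_inv g @` F) t X_inf.
- by rewrite finite_setU; split=> //; exact: finite_image.
(* A collision between the two clauses of [t] means that [h] maps a point of [F] to a point of [F],
   where [g] does the same. *)
- have mix y z : F y -> F z -> t y = t (sp_inv g z) -> y = sp_inv g z.
    move=> Fy Fz; rewrite tF // tg sp_invK // => yz.
    rewrite yz -[LHS](sp_funK g); congr (sp_inv g); apply/cE => //.
      by rewrite -yz.
    exact: sp_invK.
  move=> y y' [Fy|[z Fz <-]] [Fy'|[z' Fz' <-]].
  + by rewrite !tF.
  + exact: mix.
  + by move=> E; apply/esym/mix.
  + rewrite !tg ?sp_invK // => E; congr (sp_inv g).
    exact: (can_inj (sp_invK h)).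
exists (sp_mul h (sp_mul b (sp_V g))), (sp_V b); split.
- move=> z Fz /=; rewrite bt; last by right; exists z.
  by rewrite tg ?sp_invK.
- move=> x Fx /=; apply: (can_inj (sp_funK b)); rewrite sp_invK bt ?tF //.
  by left.
- by move=> x /=; rewrite sp_funK sp_invK.
Qed.

(** A Lebesgue number argument, with finite sets in place of radii. *)
Lemma brX_lebesgue {W : set (selfmaps X * selfmaps X)} :
    infinite_set [set: X] -> diag_nbhd (brX X) W ->
  exists F, finite_set F /\
    forall f h, brX X f -> brX X h -> agree F f h -> W (f, h).
Proof.
move=> X_inf Wdiag; apply: contrapT => nF.
have bad F : finite_set F -> exists f h, [/\ brX X f, brX X h, agree F f h & ~ W (f, h)].
  move=> Ffin; apply: contrapT => nfh; apply: nF; exists F; split=> // f h fbr hbr c.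
  by apply: contrapT => Wfh; apply: nfh; exists f, h.
have [|C D Cfin Dfin|C /bad[f [h [fbr hbr c nW]]]|f fbr clf] :=
  @compact_cluster (set X) _ (brX X) (fun C : set X => finite_set C)
   (fun C => [set f | exists h, [/\ brX X h, agree C f h & ~ W (f, h)]]) (brX_compact X_inf).
- by exists set0; exact: finite_set0.
- exists (C `|` D); first by rewrite finite_setU.
  by move=> f [h [hbr c nW]]; split; exists h; split=> //; apply: agreeS c => x;
    [left | right].
- by exists f; split=> //; exists h.
have [U [oU Uf UW]] := Wdiag f fbr; have [F [Ffin FU]] := brX_open fbr oU Uf.
have [f' [[f'br [h [hbr c nW]]] ff']] :=
  clf F _ Ffin (@agree_open F f Ffin) (@agree_refl F f).
apply: nW; apply: UW => //; first exact: FU.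
by apply: FU => //; exact: agree_trans ff' c.
Qed.

Lemma brX_roelcke : infinite_set [set: X] ->
  roelcke_compactification (brX X) (@ellis_emb X).
Proof.
move=> X_inf; split; first exact: brX_compactification.
  move=> W Wdiag; have [F [Ffin FW]] := brX_lebesgue X_inf Wdiag.
  exists F; split=> // -[g h] /(roelcke_baseP X_inf Ffin) c /=.
  by apply: FW => //; exact: ellis_emb_brX.
move=> E [F [Ffin FE]]; exists [set fh | agree F fh.1 fh.2]; split.
  move=> f fbr; exists (agree F f); split=> //; first exact: agree_open.
  by move=> h1 h2 _ _ /agree_sym c1 c2; exact: agree_trans c1 c2.
by move=> g h c; apply: FE; apply/roelcke_baseP.
Qed.

Lemma roelcke_totally_bounded :
  infinite_set [set: X] -> totally_bounded (@roelcke_ent X).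
Proof.
move=> X_inf E [F [Ffin FE]].
apply: contrapT => nC.
have [|C D Cfin Dfin|C Cfin|f fbr clf] := @compact_cluster _ _ (brX X)
   (fun C : set (sperm X) => finite_set C)
   (fun C => [set f | forall g, C g -> ~ agree F f (ellis_emb g)]) (brX_compact X_inf).
- by exists set0; exact: finite_set0.
- exists (C `|` D); first by rewrite finite_setU.
  by move=> f nf; split=> g Cg; apply: nf; [left | right].
- apply: contrapT => nf; apply: nC; exists C; split=> // a.
  apply: contrapT => na; apply: nf; exists (ellis_emb a); split; first exact: ellis_emb_brX.
  move=> g Cg /agree_sym c; apply: na; exists g; split=> //.
  by apply: FE; apply/roelcke_baseP.
(* A permutation [g] with the pattern of the cluster point [f] refutes the stage where [C] consists
   of [g] alone. *)
have [g [_ c]] := brX_approx X_inf Ffin fbr.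
have [f' [[_ nf'] ff']] :=
  clf [set g] _ (finite_set1 g) (@agree_open F f Ffin) (@agree_refl F f).
by apply: (nf' g erefl); exact: agree_trans (agree_sym ff') c.
Qed.

End Agree.

(** * The semitopological inverse monoid *)

Section Monoid.
Context {X : choiceType}.
Implicit Types (F : set X) (f h : selfmaps X) (g : sperm X).

Lemma comp_some {f h} {x z : X} : f None = None ->
  selfmaps_comp f h (Some x) = Some z <->
  exists y, h (Some x) = Some y /\ f (Some y) = Some z.
Proof.
move=> fN; rewrite /selfmaps_comp; split=> [|[y [-> //]]].
by case: (h (Some x)) => [y fy|]; [exists y | rewrite fN].
Qed.

Lemma selfmaps_comp_brX {f h} : brX X f -> brX X h -> brX X (selfmaps_comp f h).
Proof.
move=> /brXP[fN finj] /brXP[hN hinj]; apply/brXP; split.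
  by rewrite /selfmaps_comp hN.
move=> x1 x2 z /(comp_some fN)[y1 [h1 f1]] /(comp_some fN)[y2 [h2 f2]].
by apply: hinj h1 _; rewrite h2 (finj _ _ _ f2 f1).
Qed.

Lemma selfmaps_id_brX : brX X (selfmaps_id X).
Proof. by apply/brXP; split=> // x1 x2 y; rewrite /selfmaps_id => -[->] -[->]. Qed.

Lemma ellis_emb_mul g1 g2 :
  selfmaps_comp (ellis_emb g1) (ellis_emb g2) = ellis_emb (sp_mul g1 g2).
Proof. by apply/funext => -[]. Qed.

Lemma brX_within_continuous {c : selfmaps X -> selfmaps X} :
  (forall f, brX X f -> brX X (c f)) ->
  (forall F f, finite_set F -> brX X f -> exists F', finite_set F' /\
     forall h, brX X h -> agree F' f h -> agree F (c f) (c h)) ->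
  {within brX X, continuous c}.
Proof.
move=> cbr cP; apply/within_continuousP => f fbr V oV Vf.
have [F [Ffin FV]] := brX_open (cbr f fbr) oV Vf.
have [F' [F'fin F'F]] := cP F f Ffin fbr.
exists (agree F' f); split=> //; first exact: agree_open.
by move=> h hbr /(F'F h hbr); apply: FV; exact: cbr.
Qed.

Lemma brX_finite_preimage {F f} : brX X f -> finite_set F ->
  finite_set [set x | exists2 y, F y & f (Some x) = Some y].
Proof.
move=> /brXP[_ finj] Ffin.
(* Choosing preimages needs a default value, so the case of empty [X] is split off. *)
have [x0|nx] := pselect (exists x0 : X, True); last first.
  by apply: sub_finite_set (finite_set0 X) => x; case: nx; exists x.
have [x0' _] := x0.
have /choice[s sP] : forall y, exists x, (exists x', f (Some x') = Some y) -> f (Some x) = Some y.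
  move=> y; have [[x' fx']|n] := pselect (exists x', f (Some x') = Some y).
    by exists x'.
  by exists x0'.
apply: sub_finite_set (finite_image s Ffin) => x [y Fy fx].
by exists y => //; apply: (finj _ _ y) => //; apply: sP; exists x.
Qed.

(** On [F], the pattern of [f h] is read off [h] on [F] and the preimage of [F] under [f]; that of
    [h f] is read off [h] on [F] and the image of [F]. *)
Lemma selfmaps_comp_continuous {f} : brX X f ->
  {within brX X, continuous (selfmaps_comp f)} /\
  {within brX X, continuous (fun h => selfmaps_comp h f)}.
Proof.
move=> fbr; have /brXP[fN _] := fbr; split; apply: brX_within_continuous.
- by move=> h; exact: selfmaps_comp_brX.
- move=> F h Ffin hbr.
  exists (F `|` [set x | exists2 y, F y & f (Some x) = Some y]).
  rewrite finite_setU; split; first by split=> //; exact: brX_finite_preimage.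
  move=> h' _ c x z Fx Fz; split=> /(comp_some fN)[y [hy fy]]; apply/(comp_some fN);
    exists y; split=> //; apply/c => //; by [left | right; exists z].
- by move=> h hbr; exact: selfmaps_comp_brX.
- move=> F h Ffin /brXP[hN _].
  exists (F `|` [set y | exists2 x, F x & f (Some x) = Some y]).
  rewrite finite_setU; split.
    split=> //; apply: sub_finite_set (finite_image (fun x => odflt x (f (Some x))) Ffin).
    by move=> y [x Fx fx]; exists x => //; rewrite fx.
  move=> h' /brXP[h'N _] c x z Fx Fz.
  split=> [/(comp_some hN)|/(comp_some h'N)][y [fy hy]];
    [apply/(comp_some h'N) | apply/(comp_some hN)];
    exists y; split=> //; apply/c => //; by [left | right; exists x].
Qed.

Lemma brX_sm_compactification : infinite_set [set: X] ->
  sm_compactification (brX X) (@ellis_emb X) (@selfmaps_comp X) (selfmaps_id X).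
Proof.
move=> X_inf; split=> //.
- split; first exact: brX_compactification.
  split; [exact: selfmaps_id_brX | by move=> f h; exact: selfmaps_comp_brX].
- by move=> f; exact: selfmaps_comp_continuous.
- move=> g1 g2; exact: ellis_emb_mul.
move=> g p pbr V oV Vgp.
have gpbr := selfmaps_comp_brX (ellis_emb_brX g) pbr.
have [F [Ffin FV]] := brX_open gpbr oV Vgp.
(* For [z] in [F], the product takes the value [z] where [p] takes the value [g^-1 z]. So [h] has to
   agree with [g] on [F'], and [q] with [p] on [F] and [F']. *)
pose F' := sp_inv g @` F.
have F'fin : finite_set F' by exact: finite_image.
exists F', (agree (F `|` F') p); split=> //.
  by apply: agree_open; rewrite finite_setU.
move=> h q hg qbr c.
apply: FV; first exact: selfmaps_comp_brX (ellis_emb_brX h) qbr.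
move=> x z Fx Fz.
have F'z : F' (sp_inv g z) by exists z.
have hz : h (sp_inv g z) = z by rewrite hg // sp_invK.
have E (k : sperm X) (r : selfmaps X) : k (sp_inv g z) = z ->
    selfmaps_comp (ellis_emb k) r (Some x) = Some z <-> r (Some x) = Some (sp_inv g z).
  move=> kz; rewrite comp_some //; split=> [[y [ry [ky]]]|ry].
    by rewrite ry; congr Some; apply: (sp_injective k); rewrite ky kz.
  by exists (sp_inv g z); split=> //; rewrite /ellis_emb /= kz.
rewrite E ?sp_invK // E //; apply: c; by [left | right].
Qed.

Definition selfmaps_inv f : selfmaps X := fun p =>
  if p is Some y then
    if pselect (exists x, f (Some x) = Some y) is left fy then Some (projT1 (cid fy))
    else None
  else None.

Lemma selfmaps_invP {f} {x y : X} : brX X f ->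
  selfmaps_inv f (Some y) = Some x <-> f (Some x) = Some y.
Proof.
move=> /brXP[_ finj]; rewrite /selfmaps_inv; case: pselect => [fy|nfy].
  case: cid => x' fx' /=; split=> [[<- //]|fx].
  by congr Some; exact: finj fx.
by split=> // fx; case: nfy; exists x.
Qed.

Lemma selfmaps_inv_brX {f} : brX X f -> brX X (selfmaps_inv f).
Proof.
move=> fbr; apply/brXP; split=> // y1 y2 x /(selfmaps_invP fbr) fy1.
by move=> /(selfmaps_invP fbr); rewrite fy1 => -[].
Qed.

Lemma selfmaps_invK {f} : brX X f ->
  selfmaps_comp (selfmaps_comp f (selfmaps_inv f)) f = f.
Proof.
move=> fbr; have /brXP[fN _] := fbr; have fibr := selfmaps_inv_brX fbr.
apply: brX_ext => //; first exact: (selfmaps_comp_brX (selfmaps_comp_brX fbr fibr) fbr).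
move=> x y; rewrite comp_some //; split.
  move=> [z [fx /(comp_some fN)[x' [/(selfmaps_invP fbr) fx' fx'y]]]].
  by rewrite fx -fx' fx'y.
move=> fx; exists y; split=> //; apply/(comp_some fN).
by exists x; split=> //; apply/selfmaps_invP.
Qed.

Lemma selfmaps_inv_invol {f} : brX X f -> selfmaps_inv (selfmaps_inv f) = f.
Proof.
move=> fbr; have fibr := selfmaps_inv_brX fbr.
apply: brX_ext => //; first exact: selfmaps_inv_brX.
move=> x y; rewrite (selfmaps_invP fibr); exact: selfmaps_invP.
Qed.

Lemma brX_sim_compactification : infinite_set [set: X] ->
  sim_compactification (brX X) (@ellis_emb X) (@selfmaps_comp X) (selfmaps_id X).
Proof.
move=> X_inf; split; first exact: brX_sm_compactification.
exists selfmaps_inv; split.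
- by move=> f; exact: selfmaps_inv_brX.
- move=> f fbr; split; first exact: selfmaps_invK.
  rewrite -{2}(selfmaps_inv_invol fbr); apply: selfmaps_invK.
  exact: selfmaps_inv_brX.
- move=> f h fbr hbr fhf hfh; have /brXP[fN finj] := fbr; have /brXP[hN hinj] := hbr.
  (* From [a b a = a] it follows that [b] inverts [a] on its range. Used both ways, this gives [h]
     the transposed graph of [f]. *)
  have key (a b : selfmaps X) (x y : X) : brX X a -> brX X b ->
      selfmaps_comp (selfmaps_comp a b) a = a -> a (Some x) = Some y -> b (Some y) = Some x.
    move=> abr bbr; have /brXP[aN ainj] := abr; have /brXP[bN _] := bbr => E.
    rewrite -{1}E => /comp_some[|z [ax /(comp_some aN)[x' [bz ax']]]].
      by rewrite /selfmaps_comp bN.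
    have : a (Some x) = Some y by rewrite -E; apply/comp_some;
      [rewrite /selfmaps_comp bN | exists z; split=> //; apply/comp_some=> //; exists x'].
    rewrite ax => -[zy]; rewrite -zy bz; congr Some; apply: (ainj _ _ y) => //.
    by rewrite ax zy.
  apply: brX_ext => //; first exact: selfmaps_inv_brX.
  by move=> x y; rewrite selfmaps_invP //; split; exact: key.
apply: brX_within_continuous => [f|F f Ffin fbr]; first exact: selfmaps_inv_brX.
(* Inversion transposes patterns, so the same [F] works. *)
exists F; split=> // h hbr c x y Fx Fy; rewrite !selfmaps_invP //.
exact: c.
Qed.

Lemma brX_iso_IX : iso_to_IX X (brX X) (@selfmaps_comp X).
Proof.
exists (fun f x y => f (Some x) = Some y); split.
- move=> f /brXP[_ finj]; split=> [x y z fx|x y z]; last exact: finj.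
  by rewrite fx => -[].
- move=> f h fbr hbr E; apply: brX_ext => // x y.
  by have := congr1 (fun R : X -> X -> Prop => R x y) E => /= ->.
- move=> R [Rfun Rinj].
  pose f : selfmaps X := fun p => if p is Some x then
    if pselect (exists y, R x y) is left Rx then Some (projT1 (cid Rx)) else None
    else None.
  have fE x y : f (Some x) = Some y <-> R x y.
    rewrite /f; case: pselect => [Rx|nR]; last by split=> // Rxy; case: nR; exists y.
    case: cid => y' Rxy' /=; split=> [[<- //]|Rxy].
    by congr Some; exact: Rfun Rxy' Rxy.
  exists f; split; last by apply/funext => x; apply/funext => y; exact/propext/fE.
  by apply/brXP; split=> // x1 x2 y /fE R1 /fE; exact: Rinj R1.
move=> f h /brXP[fN _] _; apply/funext => x; apply/funext => y; apply/propext.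
exact: comp_some.
Qed.

End Monoid.

(** * Maximality *)

Definition pid {X : choiceType} (F : set X) : selfmaps X := fun p =>
  if p is Some x then if pselect (F x) then Some x else None else None.

Lemma pidP {X : choiceType} {F : set X} {x y : X} :
  pid F (Some x) = Some y <-> F x /\ x = y.
Proof.
rewrite /pid; case: pselect => Fx; split => //.
- by move=> [].
- by move=> [_ xy]; congr Some.
- by move=> [/Fx].
Qed.

Lemma pid_brX {X : choiceType} {F : set X} : brX X (pid F).
Proof. by apply/brXP; split=> // x1 x2 y /pidP[_ ->] /pidP[_ ->]. Qed.

Lemma agree_pid_fixes {X : choiceType} {F S : set X} {g : sperm X} :
  F `<=` S -> agree S (pid F) (ellis_emb g) -> fixes F g.
Proof. by move=> FS c x Fx; apply/(agree_emb c); [exact: FS | exact: FS | apply/pidP]. Qed.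

Lemma sp_ext {X : choiceType} {g h : sperm X} : g =1 h -> g = h.
Proof. by move=> gh; apply: ellis_emb_inj; apply/funext => -[x|] //; congr Some; exact: gh. Qed.

Section Maximality.
Context {X : choiceType} (X_inf : infinite_set [set: X]).
Context {T : topologicalType} {K : set T} {j : sperm X -> T}.
Context {mul : T -> T -> T} {one : T} (sm : sm_compactification K j mul one).
Local Notation adh := (adherent (@ellis_emb X) j).
Implicit Types (F : set X) (f : selfmaps X) (p q : T) (V : set T) (g : sperm X).

Let cK : compact K. Proof. by case: sm => [[[[? ?] _ _ _ _] _] _ _ _ _]. Qed.
Let hK : hausdorff_on K. Proof. by case: sm => [[[[? ?] _ _ _ _] _] _ _ _ _]. Qed.
Let jK g : K (j g). Proof. by case: sm => [[[_ [? ?] _ _ _] _] _ _ _ _]. Qed.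
Let jcl : K `<=` closure (range j).
Proof. by case: sm => [[[_ [? ?] _ _ _] _] _ _ _ _]. Qed.
Let jc V : open V -> sp_open (j @^-1` V).
Proof. by case: sm => [[[_ _ h _ _] _] _ _ _ _]; exact: h. Qed.
Let mulK p q : K p -> K q -> K (mul p q).
Proof. by case: sm => [[_ [_ h]] _ _ _ _]; exact: h. Qed.
Let mulA p q r : K p -> K q -> K r -> mul p (mul q r) = mul (mul p q) r.
Proof. by case: sm => [_ [h _] _ _ _]; exact: h. Qed.
Let mulc p : K p -> {within K, continuous (mul p)} /\
                    {within K, continuous (fun q => mul q p)}.
Proof. by case: sm => [_ _ h _ _]; exact: h. Qed.
Let jM g h : mul (j g) (j h) = j (sp_mul g h).
Proof. by case: sm => [_ _ _ -> _]. Qed.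

Let mul_contl {p q V} : K p -> K q -> open V -> V (mul p q) ->
  exists U, [/\ open U, U p & forall r, K r -> U r -> V (mul r q)].
Proof. by move=> Kp Kq; exact: (within_continuousP.1 (mulc _ Kq).2 p Kp). Qed.

Let mul_contr {p q V} : K p -> K q -> open V -> V (mul p q) ->
  exists U, [/\ open U, U q & forall r, K r -> U r -> V (mul p r)].
Proof. by move=> Kp Kq; exact: (within_continuousP.1 (mulc _ Kp).1 q Kq). Qed.

(** The equation holds on the dense range of [j] and extends to [K] by continuity. *)
Lemma mul_j_one {p} : K p -> mul (j (sp_one X)) p = p.
Proof.
move=> Kp; apply: contrapT => /(hK _ _ (mulK _ _ (jK _) Kp) Kp)[V [V' [oV oV' Vp V'p VV']]].
have [U [oU Up UV]] := mul_contr (jK _) Kp oV Vp.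
have [_ [[g _ <-] [Ug V'g]]] := jcl p Kp _ (open_nbhs_nbhs (conj (openI oU oV') (conj Up V'p))).
have : (V `&` V') (j g).
  split=> //; have := UV _ (jK g) Ug; rewrite jM; congr (V (j _)).
  exact: sp_ext.
by rewrite VV'.
Qed.

Lemma joint_continuity_one {p V} : K p -> open V -> V p -> exists F U,
  [/\ finite_set F, open U, U p &
      forall h q, fixes F h -> K q -> U q -> V (mul (j h) q)].
Proof.
move=> Kp oV Vp; case: sm => _ _ _ _ /(_ (sp_one X) p Kp V oV) [|F [U [Ffin oU Up FU]]].
  by rewrite mul_j_one.
by exists F, U; split=> // h q hF; exact: FU.
Qed.

Lemma adherent_agree {F f p V} : adh f p -> finite_set F -> open V -> V p ->
  exists g, agree F f (ellis_emb g) /\ V (j g).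
Proof.
by move=> fp Ffin oV Vp; apply: fp => //; exact: agree_open.
Qed.

(** Multiplication is only separately continuous, so [g] is chosen for the left factor first, and
    [h] for the right factor with [g] fixed. *)
Lemma adherent_mul {f f' p p'} : brX X f -> brX X f' -> K p -> K p' ->
  adh f p -> adh f' p' -> adh (selfmaps_comp f f') (mul p p').
Proof.
move=> fbr f'br Kp Kp' fp f'p' U V oU oV Uf Vp.
have [U1 [oU1 U1f U1U]] :=
  within_continuousP.1 (selfmaps_comp_continuous f'br).2 f fbr U oU Uf.
have [V1 [oV1 V1p V1V]] := mul_contl Kp Kp' oV Vp.
have [g [U1g V1g]] := fp U1 V1 oU1 oV1 U1f V1p.
have gbr := ellis_emb_brX g.
have [U2 [oU2 U2f' U2U]] :=
  within_continuousP.1 (selfmaps_comp_continuous gbr).1 f' f'br U oU (U1U _ gbr U1g).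
have [V2 [oV2 V2p' V2V]] := mul_contr (jK g) Kp' oV (V1V _ (jK g) V1g).
have [h [U2h V2h]] := f'p' U2 V2 oU2 oV2 U2f' V2p'.
exists (sp_mul g h); split; first by rewrite -ellis_emb_mul; apply: U2U => //; exact: ellis_emb_brX.
by rewrite -jM; exact: V2V.
Qed.

(** The absorption lemmas below treat [a] of finite support; density carries them over to limits of
    stabilisers of [F]. *)
Lemma finitary_dense {F g V} : finite_set F -> fixes F g -> open V -> V (j g) ->
  exists a, [/\ finitary a, fixes F a & V (j a)].
Proof.
move=> Ffin gF oV Vg; have [F' [F'fin F'V]] := jc V oV g Vg.
have [||a [afin ag]] := @injection_extension X (F `|` F') g X_inf.
- by rewrite finite_setU.
- by move=> x x' _ _; exact: sp_injective.
exists a; split=> //; first by move=> x Fx; rewrite ag; [exact: gF | left].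
by apply: F'V => x F'x; apply: ag; right.
Qed.

(* If [g] is close to the partial identity on [F], then [g a g^-1] is close to
   the identity: [g] moves the support of [a] far away. *)
Lemma adherent_pid_mulr {F p a} : K p -> adh (pid F) p ->
  finite_set F -> finitary a -> fixes F a -> mul p (j a) = p.
Proof.
move=> Kp Fp Ffin [S [Sfin aS]] aF; apply: contrapT.
move=> /(hK _ _ (mulK _ _ Kp (jK a)) Kp)[V1 [V2 [oV1 oV2 V1p V2p V12]]].
have [U1 [oU1 U1p U1V1]] := mul_contl Kp (jK a) oV1 V1p.
have [F' [U2 [F'fin oU2 U2p F'V2]]] := joint_continuity_one Kp oV2 V2p.
have [|g [c [U1g U2g]]] := @adherent_agree (F `|` F' `|` S) _ _ (U1 `&` U2) Fp _ (openI oU1 oU2) (conj U1p U2p).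
  by rewrite !finite_setU.
(* Since [g a = k g], the point [j (g a)] is near [p a] by the choice of [g], and near [p] once [k]
   fixes [F']. *)
pose k := sp_mul g (sp_mul a (sp_V g)).
have kF' : fixes F' k.
  move=> x F'x; rewrite /k /=; set y := sp_inv g x.
  have gy : g y = x by rewrite /y sp_invK.
  have [ay|ay] := pselect (a y = y); first by rewrite ay.
  have Sy : S y by apply: contrapT => nSy; apply: ay; exact: aS.
  have /pidP[Fy _] : pid F (Some y) = Some x.
    by apply/(agree_emb c) => //; [right | left; right].
  by case: ay; exact: aF.
have : (V1 `&` V2) (mul (j g) (j a)).
  split; first exact: U1V1.
  rewrite jM (_ : sp_mul g a = sp_mul k g); last by apply: sp_ext => x /=; rewrite sp_funK.
  by rewrite -jM; exact: F'V2.
by rewrite V12.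
Qed.

(* Choose [c n] near [p] such that the sets [c n ^-1 (F' \ F)] are disjoint and
   put [d n = prod_(m < n) c m ^-1 a c m].  Then [c m * d n] is close to [c m] if
   [n <= m] and to [a * c m] if [m < n], so the double limit is close to both [p]
   and [a p]. *)
Lemma adherent_pid_mull {F p a} : K p -> adh (pid F) p ->
  finite_set F -> finitary a -> fixes F a -> mul (j a) p = p.
Proof.
move=> Kp Fp Ffin [A [Afin aA]] aF; apply: contrapT.
move=> /(hausdorff_on_closure cK hK (mulK _ _ (jK a) Kp) Kp)[V1 [V2 [oV1 oV2 V1p V2p V12]]].
have [F1 [U1 [F1fin oU1 U1p F1V1]]] := joint_continuity_one (mulK _ _ (jK a) Kp) oV1 V1p.
have [F2 [U2 [F2fin oU2 U2p F2V2]]] := joint_continuity_one Kp oV2 V2p.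
have [U3 [oU3 U3p U3U1]] := mul_contr (jK a) Kp oU1 U1p.
(* Including the support of [a] makes [F'] invariant under [a]. *)
pose F' := F1 `|` F2 `|` A.
have F'fin : finite_set F' by rewrite !finite_setU.
have aF' x : a x <> x -> F' x by move=> ax; right; apply: contrapT => /aA.
have aF'_inv x : F' (a x) -> F' x.
  by move=> F'ax; have [<-//|] := pselect (a x = x); exact: aF'.
have aF'_im x : F' x -> F' (a x).
  move=> F'x; have [aax|] := pselect (a (a x) = a x); last exact: aF'.
  by rewrite (sp_injective a _ _ aax).
(* With [S] the union of the earlier preimages of [F'], the last clause makes the new preimage meet
   them only inside [F]. *)
pose good (S : set X) g := [/\ fixes F g, U2 (j g), U3 (j g) &
  forall y, S y -> F' (g y) -> F y].
(* The value [a] at infinite [S] is arbitrary. *)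
have /choice[C Cgood] : forall S, exists g, finite_set S -> good S g.
  move=> S; have [Sfin|nS] := pselect (finite_set S); last by exists a.
  have [|g [c [U2g U3g]]] := @adherent_agree (F `|` F' `|` S) _ _ (U2 `&` U3) Fp _ (openI oU2 oU3) (conj U2p U3p).
    by rewrite !finite_setU.
  exists g => _; split=> //.
    by apply: agree_pid_fixes c => x Fx; left; left.
  move=> y Sy F'gy; suff /pidP[] : pid F (Some y) = Some (g y) by [].
  by apply/(agree_emb c) => //; [right | left; right].
pose conj_a g := sp_mul (sp_V g) (sp_mul a g).
(* The state holds the preimages of [F'] under the earlier [c m], and the product [d n]. *)
pose st := fix st n : set X * sperm X := if n is n'.+1 then
    ((st n').1 `|` sp_inv (C (st n').1) @` F',
     sp_mul (st n').2 (conj_a (C (st n').1)))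
  else (set0, sp_one X).
pose S n := (st n).1; pose d n := (st n).2; pose c n := C (S n).
have Sfin n : finite_set (S n).
  elim: n => [|n IHn]; first exact: finite_set0.
  by rewrite /S /= finite_setU; split=> //; exact: finite_image.
have cgood n : good (S n) (c n) by exact: Cgood.
have cF n : fixes F (c n) by case: (cgood n).
have cS n y : S n y -> F' (c n y) -> F y by case: (cgood n) => _ _ _; exact.
have dS1 n y : d n.+1 y = d n (sp_inv (c n) (a (c n y))) by [].
have SS1 n y : F' (c n y) -> S n.+1 y.
  by move=> F'cy; right; exists (c n y) => //; exact: sp_funK.
have Smono m n : (m <= n)%N -> S m `<=` S n.
  elim: n => [|n IHn]; first by rewrite leqn0 => /eqP ->.
  by rewrite leq_eqVlt ltnS => /predU1P[->//|/IHn mn y /mn ?]; left.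
have d_out n y : ~ S n y -> d n y = y.
  elim: n => // n IHn nSy.
  have nF' : ~ F' (c n y) by move/SS1.
  rewrite dS1 (_ : a (c n y) = c n y); last by apply: contrapT => /aF'.
  by rewrite sp_funK; apply: IHn => Sy; apply: nSy; left.
have dF n : fixes F (d n).
  elim: n => // n IHn y Fy; rewrite dS1 cF // aF // -{1}(cF n y Fy) sp_funK.
  exact: IHn.
(* On the preimage of [F'] minus [F] under [c m], only the factor with index [m] acts. *)
have d_in m n y : (m < n)%N -> F' (c m y) -> ~ F y ->
    d n y = sp_inv (c m) (a (c m y)).
  elim: n => // n IHn; rewrite ltnS leq_eqVlt => /predU1P[<-|mn] F'y nFy.
    rewrite dS1; set z := sp_inv _ _; apply: d_out => Sz.
    have cz : c m z = a (c m y) by rewrite /z sp_invK.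
    have Fz : F z by apply: (cS m) => //; rewrite cz; exact: aF'_im.
    apply: nFy; suff -> : y = z by [].
    apply: (sp_injective (c m)); apply: (sp_injective a).
    by rewrite -cz cF // aF.
  rewrite dS1 (_ : a (c n y) = c n y) ?sp_funK; first exact: IHn.
  apply: contrapT => /aF' F'cy; apply: nFy; apply: (cS n) => //.
  by apply: Smono mn _ _; exact: SS1.
have [||||r [[Kr V2r] V1r]] := @double_limit T K mul V2 V1 (j \o c) (j \o d) cK mulK mulc.
- by move=> n; exact: jK.
- by move=> n; exact: jK.
(* Here [k = c m d n (c m)^-1] fixes [F2], so [c m d n = k c m] stays near [p]. *)
- move=> m n nm /=; rewrite jM.
  pose k := sp_mul (sp_mul (c m) (d n)) (sp_V (c m)).
  rewrite (_ : sp_mul _ _ = sp_mul k (c m)); last by apply: sp_ext => x /=; rewrite sp_funK.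
  rewrite -jM; apply: F2V2 => //; last by case: (cgood m).
  move=> x F2x; rewrite /k /=; set y := sp_inv (c m) x.
  have cy : c m y = x by rewrite /y sp_invK.
  suff -> : d n y = y by [].
  have [Fy|nFy] := pselect (F y); first exact: dF.
  apply: d_out => Sy; apply: nFy; apply: (cS m); first exact: Smono nm _ _.
  by rewrite cy; left; right.
(* Now [d n] contains the conjugate of [a] by [c m], so [c m d n] is [a c m] up to a left factor [k]
   fixing [F1]. *)
- move=> m n mn /=; rewrite jM.
  pose k := sp_mul (sp_mul (c m) (d n)) (sp_V (sp_mul a (c m))).
  rewrite (_ : sp_mul _ _ = sp_mul k (sp_mul a (c m))); last first.
    by apply: sp_ext => x /=; rewrite !sp_funK.
  rewrite -jM; apply: F1V1 => //; last first.
    by rewrite -jM; apply: U3U1 => //; case: (cgood m).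
  move=> x F1x; rewrite /k /=; set x' := sp_inv a x; set y := sp_inv (c m) x'.
  have ax' : a x' = x by rewrite /x' sp_invK.
  have cy : c m y = x' by rewrite /y sp_invK.
  have F'x' : F' x' by apply: aF'_inv; rewrite ax'; left; left.
  have [Fy|nFy] := pselect (F y).
    by rewrite dF // cy -[in RHS]ax' -cy cF // aF.
  by rewrite (d_in m) ?cy // ax' sp_invK.
have : (K `&` closure V1 `&` closure V2) r by [].
by rewrite V12.
Qed.

(** Permutations of finite support fixing [F] approach both points. They fix [q] from the left, so
    [p q = q], and [p] from the right, so [p q = p]. *)
Lemma adherent_pid_unique {F p q} : finite_set F -> K p -> K q ->
  adh (pid F) p -> adh (pid F) q -> p = q.
Proof.
move=> Ffin Kp Kq Fp Fq; have Kpq := mulK _ _ Kp Kq.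
have near r U : open U -> U r -> adh (pid F) r ->
    exists a, [/\ finitary a, fixes F a & U (j a)].
  move=> oU Ur Fr; have [g [c Ug]] := adherent_agree Fr Ffin oU Ur.
  by apply: finitary_dense oU Ug => //; exact: agree_pid_fixes c.
have pq_q : mul p q = q.
  apply: contrapT => /(hK _ _ Kpq Kq)[V [V' [oV oV' Vpq V'q VV']]].
  have [U [oU Up UV]] := mul_contl Kp Kq oV Vpq.
  have [a [afin aF Ua]] := near p U oU Up Fp.
  have : (V `&` V') q.
    by split=> //; rewrite -(adherent_pid_mull Kq Fq Ffin afin aF); exact: UV.
  by rewrite VV'.
apply: contrapT => pq; rewrite -pq_q in pq.
have [V [V' [oV oV' Vp V'pq VV']]] := hK _ _ Kp Kpq pq.
have [U [oU Uq UV']] := mul_contr Kp Kq oV' V'pq.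
have [a [afin aF Ua]] := near q U oU Uq Fq.
have : (V `&` V') p.
  by split=> //; rewrite -(adherent_pid_mulr Kp Fp Ffin afin aF); exact: UV'.
by rewrite VV'.
Qed.

(** A permutation [g] extending [f] from its finite domain reduces the claim to a partial identity,
    since translation by [j g] is invertible on [K]. *)
Lemma adherent_finite_rank_unique {f p q} : brX X f ->
    finite_set [set x | f (Some x) <> None] -> K p -> K q ->
  adh f p -> adh f q -> p = q.
Proof.
move=> fbr Afin Kp Kq fp fq; have /brXP[fN finj] := fbr.
have [|g [_ gA]] := @injection_extension X _ (fun x => odflt x (f (Some x))) X_inf Afin.
  move=> x x' /=; case fx: (f (Some x)) => [y|] // _.
  case fx': (f (Some x')) => [y'|] // _ /= yy'; apply: finj fx _.
  by rewrite yy'.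
have E : selfmaps_comp (ellis_emb (sp_V g)) f = pid [set x | f (Some x) <> None].
  apply/funext => -[x|]; last by rewrite /selfmaps_comp fN.
  rewrite /selfmaps_comp /pid; case: pselect => [Ax|/contrapT -> //].
  have := gA x Ax; move: Ax => /=; case: (f (Some x)) => [y|] // _ /= <-.
  by rewrite /ellis_emb /= sp_funK.
have cancel r : K r -> mul (j g) (mul (j (sp_V g)) r) = r.
  move=> Kr; rewrite mulA // jM (_ : sp_mul _ _ = sp_one X) ?mul_j_one //.
  by apply: sp_ext => x /=; exact: sp_invK.
rewrite -(cancel p Kp) -(cancel q Kq); congr mul.
have gV r : K r -> adh f r -> adh (pid [set x | f (Some x) <> None]) (mul (j (sp_V g)) r).
  move=> Kr fr; rewrite -E; apply: adherent_mul => //; first exact: ellis_emb_brX.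
  exact: adherent_diag.
by apply: (adherent_pid_unique Afin); [exact: mulK | exact: mulK | exact: gV | exact: gV].
Qed.

(* The points [u_F] over the finite partial identities tend to the unit, and
   [u_F p] lies over an element of finite rank. *)
Lemma adherent_unique {f p q} : brX X f -> K p -> K q -> adh f p -> adh f q -> p = q.
Proof.
move=> fbr Kp Kq fp fq; apply: contrapT => /(hK _ _ Kp Kq)[V [V' [oV oV' Vp V'q VV']]].
have K1 := jK (sp_one X).
have [|U [oU U1 UV]] := @mul_contl (j (sp_one X)) p V K1 Kp oV; first by rewrite mul_j_one.
have [|U' [oU' U'1 UV']] := @mul_contl (j (sp_one X)) q V' K1 Kq oV'; first by rewrite mul_j_one.
have [W [oW W1 WU]] :=
  compact_hausdorff_on_regular cK hK K1 (openI oU oU') (conj U1 U'1).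
have [F [Ffin FW]] := jc W oW (sp_one X) W1.
have [|u Ku Fu] := @adherent_total _ _ _ K (@ellis_emb X) j (pid F) cK jK.
  by rewrite -/(ellis_space X) ellis_spaceE //; exact: pid_brX.
(* Permutations close to [pid F] fix [F], so [j] sends them into [W]; hence [u] is in the closure of
   [W]. *)
have [Uu U'u] : (U `&` U') u.
  apply: WU; split=> // O; rewrite nbhsE => -[O' [oO' O'u] O'O].
  have [g [c O'g]] := adherent_agree Fu Ffin oO' O'u.
  exists (j g); split; last exact: O'O.
  by apply: FW => x Fx; rewrite (agree_pid_fixes _ c).
have upq : mul u p = mul u q.
  apply: (@adherent_finite_rank_unique (selfmaps_comp (pid F) f)).
  - by apply: selfmaps_comp_brX => //; exact: pid_brX.
  - apply: sub_finite_set (brX_finite_preimage fbr Ffin) => x.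
    rewrite /selfmaps_comp /=; case: (f (Some x)) => [y|] //= ; case: pselect => // Fy _.
    by exists y.
  - exact: mulK.
  - exact: mulK.
  - by apply: adherent_mul => //; exact: pid_brX.
  - by apply: adherent_mul => //; exact: pid_brX.
have : (V `&` V') (mul u p) by split; [exact: UV | rewrite upq; exact: UV'].
by rewrite VV'.
Qed.

End Maximality.

Lemma brX_max_sm_compactification {X : choiceType} : infinite_set [set: X] ->
  max_sm_compactification (brX X) (@ellis_emb X) (@selfmaps_comp X) (selfmaps_id X).
Proof.
move=> X_inf; split; first exact: brX_sm_compactification.
move=> T K j mul one sm.
have [[[[cK _] [jK _] _ _ _] _] _ _ _ _] := sm.
have [|||h [hP hc hj]] := @adherent_map _ _ _ (brX X) K (@ellis_emb X) j cK (@ellis_emb_brX X) jK.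
- by rewrite -ellis_spaceE.
- by exists (sp_one X).
- by move=> f p q fbr Kp Kq; exact: (adherent_unique X_inf sm).
by exists h; split=> // f /hP[].
Qed.

Theorem mainTheorem8 (X : choiceType) (X_infinite : infinite_set [set: X]) :
  (* (a) alpha X is the unique G-compactification of X *)
  (G_compactification [set: alphaX X] (@alpha_emb X) /\
   forall (T : topologicalType) (K : set T) (j : X -> T),
     G_compactification K j ->
     compactification_iso K j [set: alphaX X] (@alpha_emb X)) /\
  (* (b) e_{alpha X} G = b_r G, and G is Roelcke precompact *)
  (roelcke_compactification (ellis_space X) (@ellis_emb X) /\
   totally_bounded (@roelcke_ent X)) /\
  (* (c) description of b_r G as a set of self-maps of alpha X *)
  (ellis_space X = brX X /\
   roelcke_compactification (brX X) (@ellis_emb X)) /\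
  (* (d) b_r G is a sim-compactification, isomorphic to I_X, and the
     maximal sm-compactification of G *)
  (sim_compactification (brX X) (@ellis_emb X) (@selfmaps_comp X) (selfmaps_id X) /\
   iso_to_IX X (brX X) (@selfmaps_comp X) /\
   max_sm_compactification (brX X) (@ellis_emb X) (@selfmaps_comp X) (selfmaps_id X)).
Proof.
have brE := ellis_spaceE X_infinite; have br := brX_roelcke X_infinite.
split; [split | split; [split | split; [split | split; [|split]]]].
- exact: alpha_G_compactification.
- by move=> T K j; exact: G_compactification_unique.
- by rewrite brE.
- exact: roelcke_totally_bounded.
- exact: brE.
- exact: br.
- exact: brX_sim_compactification.
- exact: brX_iso_IX.
- exact: brX_max_sm_compactification.
Qed.
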